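(* For all sufficiently large square-free integers $d>0$, $$\sum_{r\in\mathcal{D}}2^{\omega(d)-\omega(\gcd(d,r))}\ge c\,d$$ for an absolute constant $c>0$, where $\mathcal{D}=\{r\in\mathbb{Z}: 0<r<d/4,\ r \text{ is a square modulo } d,\ r\neq\alpha^2+d\beta^2 \text{ for all } \alpha,\beta\in\mathbb{Q}\}$.
   Context: $\omega(n)$ denotes the number of distinct prime divisors of $n$. ''$r$ is a square modulo $d$'' means $r\equiv x^2\pmod d$ for some integer $x$. *)

(* Defs.v *)
From mathcomp Require Import all_boot all_order all_algebra.
From mathcomp Require Import boolp reals.
Set Implicit Arguments. Unset Strict Implicit. Unset Printing Implicit Defensive.
Import Order.TTheory GRing.Theory Num.Theory.

Definition omega (n : nat) : nat := size (primes n).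

Definition squarefree (d : nat) : Prop :=
  forall p : nat, prime p -> ~~ (p * p %| d).

Definition is_square_mod (d : nat) (r : int) : Prop :=
  exists x : int, (r = x ^+ 2 %[mod d%:Z])%Z.

Definition rat_rep (d : nat) (r : int) : Prop :=
  (exists a b : rat, (r%:~R : rat) = a ^+ 2 + d%:R * b ^+ 2)%R.

Definition in_D (d r : nat) : bool :=
  [&& 0 < r, 4 * r < d, `[< is_square_mod d r%:Z >] & `[< ~ rat_rep d r%:Z >]].

Definition Dsum (d : nat) : nat :=
  \sum_(0 <= r < d | in_D d r) 2 ^ (omega d - omega (gcdn d r)).

(* Main.v *)
Require Import Defs.
From mathcomp Require Import all_boot all_order all_algebra.
From mathcomp Require Import boolp reals.
From mathcomp Require Import zify ring lra.
Set Implicit Arguments.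
Unset Strict Implicit.
Unset Printing Implicit Defensive.
Import Order.TTheory GRing.Theory Num.Theory.
Local Open Scope ring_scope.

(** Summing over the squares r modulo d with weight 2^(omega d - omega (gcd d r)) amounts to summing
    the product of 1 + (r/p) over the odd primes p | d. The correlations of Legendre symbols give the
    second moment of this weight, hence its equidistribution in progressions as soon as their length
    exceeds d^(1/2+eps); it remains to exhibit enough r that are not of the form a^2 + d b^2.

    Unless d = 7 mod 8, a whole residue class modulo 8 consists of such r, by 2-adic descent.
    If d = 7 mod 8, let chi be the Jacobi symbol modulo d. An odd prime q with chi(q) = -1 and q || r
    excludes r, by reciprocity; an odd prime q | d excludes half of the r with q || r. By the variance
    of chi in short intervals, about half of the odd n up to d^(1/2+eps) satisfy chi(n) <> 1, so they
    have a prime factor q with chi(q) <> 1. Chebyshev's bound shows that the primes between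
    d^(1/2-eps) and d^(1/2+eps) account for few of them (Vinogradov's trick), so the sum of 1/q over
    the remaining q is bounded below. Finally one counts the r excluded by at least one of these q:
    by a second moment argument for q <= d^(1/5), and for larger q because an r < d has at most five
    such prime factors. *)

(** * Quadratic characters of prime fields *)
Lemma sum_Fp (V : nmodType) (p : nat) (f : 'F_p -> V) :
  prime p -> \sum_(0 <= a < p) f a%:R = \sum_x f x.
Proof.
move=> p_pr.
have -> : index_iota 0 p = index_iota 0 (Zp_trunc (pdiv p)).+2 by rewrite Fp_cast.
by rewrite big_mkord; apply: eq_bigr => i _; rewrite natr_Zp.
Qed.

Lemma Fp_nat_eq0 (p n : nat) : prime p -> (n%:R == 0 :> 'F_p) = (p %| n)%N.
Proof. by move=> p_pr; rewrite (dvdn_pcharf (pchar_Fp p_pr)). Qed.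

Lemma Fp_nat_eq (p a b : nat) : prime p -> (a%:R == b%:R :> 'F_p) = (a == b %[mod p]).
Proof.
move=> p_pr; wlog le_ba : a b / (b <= a)%N.
  by move=> W; case: (leqP b a) => [|/ltnW] /W // e; rewrite eq_sym e eq_sym.
by rewrite eqn_mod_dvd // -Fp_nat_eq0 // natrB // subr_eq0.
Qed.

Lemma Fp_two_neq0 (p : nat) : prime p -> odd p -> 2 != 0 :> 'F_p.
Proof.
move=> p_pr p_odd; rewrite Fp_nat_eq0 //.
by apply/negP => /prime_nt_dvdP -/(_ isT); case: p p_pr p_odd => [|[|[|]]] //= p _ _ /(_ isT).
Qed.

(** The Legendre symbol, taken through Euler's criterion so that multiplicativity is immediate; that
    the value 1 means a square is [chi_residue]. *)
Definition chi (p : nat) (x : 'F_p) : int :=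
  if x == 0 then 0 else if x ^+ p.-1./2 == 1 then 1 else -1.
Arguments chi : clear implicits.

Section Chi.
Variables (p : nat) (p_pr : prime p) (p_odd : odd p).
Implicit Types x y : 'F_p.

Let half_p : (p.-1./2.*2 = p.-1)%N.
Proof. by rewrite halfK; have := prime_gt0 p_pr; case: p p_odd => //= n /negbTE ->; rewrite subn0. Qed.

Lemma half_pred_gt0 : (0 < p.-1./2)%N.
Proof. by have := prime_gt1 p_pr; case: p p_odd half_p => [|[|[|n]]] // _; lia. Qed.

Lemma Fp_fermat x : x != 0 -> x ^+ p.-1 = 1.
Proof.
move=> x0; apply: (mulfI x0); rewrite mulr1 -exprS prednK ?prime_gt0 //.
rewrite -[x]natr_Zp -natrX; apply/eqP; rewrite Fp_nat_eq //; apply/eqP.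
exact: fermat_little.
Qed.

Lemma Fp_exp_half x : x != 0 -> x ^+ p.-1./2 = 1 \/ x ^+ p.-1./2 = -1.
Proof.
move=> x0; have : (x ^+ p.-1./2) ^+ 2 == 1 by rewrite -exprM muln2 half_p Fp_fermat.
by rewrite sqrf_eq1 => /orP[] /eqP; [left|right].
Qed.

Lemma Fp_neq1N1 : (1 : 'F_p) != -1.
Proof. by rewrite -subr_eq0 opprK; exact: Fp_two_neq0. Qed.

Lemma chi_cast x : (chi p x)%:~R = x ^+ p.-1./2 :> 'F_p.
Proof.
rewrite /chi; case: eqVneq => [->|x0].
  by rewrite expr0n eqn0Ngt half_pred_gt0.
by case: (Fp_exp_half x0) => ->; rewrite ?eqxx // eq_sym (negbTE Fp_neq1N1).
Qed.

Lemma chi0 : chi p 0 = 0. Proof. by rewrite /chi eqxx. Qed.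

Lemma chi1 : chi p 1 = 1. Proof. by rewrite /chi oner_eq0 expr1n eqxx. Qed.

Lemma chi_sq x : chi p x * chi p x = (x != 0)%:R.
Proof. by rewrite /chi; case: eqP => // _; case: eqP. Qed.

Lemma chiM x y : chi p (x * y) = chi p x * chi p y.
Proof.
rewrite /chi mulf_eq0; case: (eqVneq x 0) => [_|x0] /=; first by rewrite mul0r.
case: (eqVneq y 0) => [_|y0] /=; first by rewrite mulr0.
rewrite exprMn.
have e : (-1 == 1 :> 'F_p) = false by rewrite eq_sym (negbTE Fp_neq1N1).
by case: (Fp_exp_half x0) => ->; case: (Fp_exp_half y0) => ->; rewrite ?mulrNN ?mulr1 ?mul1r ?eqxx ?e.
Qed.

Lemma chi_square y : y != 0 -> chi p (y ^+ 2) = 1.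
Proof. by move=> y0; rewrite expr2 chiM chi_sq y0. Qed.

Let Xh_size : size ('X^(p.-1./2) - 1 : {poly 'F_p}) = (p.-1./2).+1.
Proof. by rewrite -polyC1 size_XnsubC // half_pred_gt0. Qed.

Let Xh_root x : root ('X^(p.-1./2) - 1 : {poly 'F_p}) x = (x ^+ p.-1./2 == 1).
Proof. by rewrite /root !hornerE subr_eq0. Qed.

Lemma card_Fp_neq0 : #|[pred x : 'F_p | x != 0]| = p.-1.
Proof.
by have := cardsC1 (0 : 'F_p); rewrite card_Fp // => <-; apply: eq_card => x; rewrite !inE.
Qed.

(** Otherwise all p - 1 nonzero elements would be roots of X^((p-1)/2) - 1, too many for its
    degree. *)
Lemma chi_nonresidue : exists x, chi p x = -1.
Proof.
case: (pickP (fun x => chi p x == -1)) => [x /eqP|none]; first by exists x.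
have all1 x : x != 0 -> x ^+ p.-1./2 == 1.
  by move=> x0; have := none x; rewrite /chi (negbTE x0); case: ifP.
have := @roots_geq_poly_eq0 _ ('X^(p.-1./2) - 1) (enum [pred x : 'F_p | x != 0]).
rewrite enum_uniq Xh_size -cardE.
rewrite card_Fp_neq0.
move=> /(_ _ isT _) /eqP; rewrite -size_poly_eq0 Xh_size => H.
apply: (False_ind _ (notF _)); apply: H.
  by apply/allP => x; rewrite mem_enum inE => /all1; rewrite Xh_root.
by have := half_pred_gt0; have := half_p; lia.
Qed.

(** The squares of 1, ..., (p-1)/2 are distinct and already exhaust the possible roots of
    X^((p-1)/2) - 1; a nonsquare root would be one too many. *)
Lemma chi_residue x : chi p x = 1 -> exists y, x = y ^+ 2.
Proof.
move=> cx; have x0 : x != 0 by apply: contra_eq_neq cx => ->; rewrite chi0.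
case: (pickP (fun y => x == y ^+ 2)) => [y /eqP|none]; first by exists y.
pose rs := x :: [seq (i%:R : 'F_p) ^+ 2 | i <- iota 1 p.-1./2].
have := @roots_geq_poly_eq0 _ ('X^(p.-1./2) - 1) rs.
rewrite Xh_size /= size_map size_iota leqnn => /(_ _ _ isT) H.
suff /eqP : ('X^(p.-1./2) - 1 : {poly 'F_p}) = 0 by rewrite -size_poly_eq0 Xh_size.
have nz i : i \in iota 1 p.-1./2 -> (i%:R : 'F_p) != 0.
  rewrite mem_iota Fp_nat_eq0 // => /andP[i0 ih]; apply/negP => /dvdn_leq; have := half_p; lia.
have rootchi z : chi p z = 1 -> root ('X^(p.-1./2) - 1 : {poly 'F_p}) z.
  by rewrite Xh_root -chi_cast => ->.
apply: H.
  rewrite rootchi //=; apply/allP => _ /mapP[i iI ->]; apply: rootchi; exact/chi_square/nz.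
apply/andP; split; first by apply/mapP => -[i _ xi]; have := none i%:R; rewrite xi eqxx.
rewrite map_inj_in_uniq ?iota_uniq // => i j; rewrite !mem_iota => iI jI /eqP.
wlog le_ji : i j iI jI / (j <= i)%N.
  move=> W; case: (leqP j i) => [le|/ltnW le]; first exact: W.
  by rewrite eq_sym => e; symmetry; apply: W.
rewrite eqf_sqr -subr_eq0 -natrB // -[X in _ || X]subr_eq0 opprK -natrD !Fp_nat_eq0 //.
move: iI jI => /andP[i0 ih] /andP[j0 jh]; have [//|ne_ij] := eqVneq i j.
have p_small : (i + j < p)%N by have := half_p; have := prime_gt0 p_pr; lia.
case/orP => /dvdn_leq le_p.
  by suff : (p <= i - j)%N; [lia | apply: le_p; lia].
by suff : (p <= i + j)%N; [lia | apply: le_p; lia].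
Qed.

Lemma sum_chi_scale (V : nmodType) (f : 'F_p -> V) (c : 'F_p) :
  c != 0 -> \sum_x f (c * x) = \sum_x f x.
Proof.
by move=> c0; rewrite [RHS](reindex (fun x => c * x)) //; exists ( *%R c^-1) => x _; rewrite ?mulKf ?mulVKf.
Qed.

(** Scaling the variable by a nonresidue changes the sign of the sum. *)
Lemma sum_chi : \sum_x chi p x = 0.
Proof.
have [c cc] := chi_nonresidue.
have c0 : c != 0 by apply: contra_eq_neq cc => ->; rewrite chi0.
have := sum_chi_scale (chi p) c0.
under eq_bigr do rewrite chiM cc mulN1r.
by rewrite sumrN; set S := \sum_x _; lia.
Qed.

(** For h != 0, factoring x out of x + h and inverting x turns the summand into chi(1 + h x) over x
    != 0: a complete sum, which vanishes, less its term 1 at x = 0. *)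
Lemma chi_correlation h : \sum_x chi p x * chi p (x + h) = p%:R * (h == 0)%:R - 1.
Proof.
case: eqVneq => [->|h0].
  under eq_bigr do rewrite addr0 chi_sq.
  rewrite -natr_sum -big_mkcond sum1_card.
  have -> : #|(fun x : 'F_p => x != 0)| = p.-1 by rewrite -card_Fp_neq0; apply: eq_card.
  by have := prime_gt0 p_pr; rewrite mulr1; lia.
rewrite mulr0 (bigD1 0) //= chi0 mul0r add0r.
have -> : \sum_(x | x != 0) chi p x * chi p (x + h) = \sum_(x : 'F_p | x != 0) chi p (1 + h * x).
  rewrite [RHS](reindex_inj invr_inj) /=; apply: eq_big => x; first by rewrite invr_eq0.
  move=> x0; have -> : x + h = x * (1 + h / x) by field.
  by rewrite chiM mulrA chi_sq x0 mul1r.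
have := sum_chi_scale (fun x => chi p (1 + x)) h0.
rewrite (bigD1 0) //= mulr0 addr0 chi1 => e.
have : \sum_(x : 'F_p) chi p (1 + x) = 0.
  rewrite -[RHS]sum_chi; symmetry; exact: (reindex_inj (addrI 1)).
by rewrite -e; set S := \sum_(_ | _) _; lia.
Qed.
End Chi.

Definition leg (p n : nat) : int := chi p n%:R.

(** For an odd prime [p], the number of square roots of [n] modulo [p]. *)
Definition rho (p n : nat) : int := 1 + leg p n.

(** For distinct odd primes, the number of square roots of [n] modulo their product. *)
Definition wt (P : seq nat) (n : nat) : int := \prod_(p <- P) rho p n.

(** The Jacobi symbol with denominator the product of [P]. *)
Definition jac (P : seq nat) (n : nat) : int := \prod_(p <- P) leg p n.

Section Legendre.
Variables (p : nat) (p_pr : prime p) (p_odd : odd p).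

Lemma leg_mod n : leg p (n %% p) = leg p n.
Proof. by rewrite /leg Fp_nat_mod. Qed.

Lemma leg_eqmod a b : a = b %[mod p] -> leg p a = leg p b.
Proof. by move=> ab; rewrite -leg_mod ab leg_mod. Qed.

Lemma legM a b : leg p (a * b) = leg p a * leg p b.
Proof. by rewrite /leg natrM chiM. Qed.

Lemma leg1 : leg p 1 = 1. Proof. exact: chi1. Qed.

Lemma leg_eq0 n : (leg p n == 0) = (p %| n)%N.
Proof. by rewrite -Fp_nat_eq0 // /leg /chi; case: ifP => // _; case: ifP. Qed.

Lemma legP n : [\/ (p %| n)%N /\ leg p n = 0, ~~ (p %| n)%N /\ leg p n = 1
                 | ~~ (p %| n)%N /\ leg p n = -1].
Proof.
rewrite -Fp_nat_eq0 // /leg /chi; case: ifP => _; first by constructor 1.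
by case: ifP => _; [constructor 2 | constructor 3].
Qed.

Lemma sum_leg_affine (m b : nat) : ~~ (p %| m)%N -> \sum_(0 <= a < p) leg p (m * a + b) = 0.
Proof.
rewrite -Fp_nat_eq0 // => m0; rewrite -[RHS](sum_chi p_pr p_odd).
rewrite -(sum_chi_scale _ m0) [RHS](reindex_inj (addrI (b%:R / m%:R))) -(sum_Fp _ p_pr).
apply: eq_bigr => a _; rewrite /leg natrD natrM; congr (chi _ _); field.
exact: m0.
Qed.

Lemma leg_correlation (m c b b' : nat) : ~~ (p %| m)%N ->
  \sum_(0 <= a < p) leg p (m * (a + b) + c) * leg p (m * (a + b') + c)
    = p%:R * (b == b' %[mod p])%:R - 1.
Proof.
rewrite -Fp_nat_eq0 // => m0.
have := chi_correlation p_pr p_odd (m%:R * (b'%:R - b%:R)).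
have -> : (m%:R * (b'%:R - b%:R) == 0 :> 'F_p) = (b == b' %[mod p]).
  by rewrite mulf_eq0 (negbTE m0) /= subr_eq0 Fp_nat_eq // eq_sym.
move<-; rewrite -(sum_chi_scale _ m0).
rewrite [RHS](reindex_inj (addrI (b%:R + c%:R / m%:R))) -(sum_Fp _ p_pr).
apply: eq_bigr => a _; rewrite /leg !natrD !natrM !natrD.
by congr (_ * _); congr (chi p _); field.
Qed.

Lemma rho_mod n : rho p (n %% p) = rho p n.
Proof. by rewrite /rho leg_mod. Qed.

Lemma rho_dvd n : (p %| n)%N -> rho p n = 1.
Proof. by rewrite -leg_eq0 /rho => /eqP->. Qed.

Lemma rho_ge0 n : 0 <= rho p n.
Proof. by rewrite /rho; case: (legP n) => [] [_ ->]. Qed.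

Lemma rho_le2 n : rho p n <= 2.
Proof. by rewrite /rho; case: (legP n) => [] [_ ->]. Qed.

Lemma sum_rho_affine (m b : nat) : ~~ (p %| m)%N -> \sum_(0 <= a < p) rho p (m * a + b) = p%:R.
Proof.
move=> pm; rewrite big_split /= sum_leg_affine // addr0.
by rewrite big_const_nat subn0 iter_addr addr0.
Qed.

Lemma rho_correlation (m c b b' : nat) : ~~ (p %| m)%N ->
  \sum_(0 <= a < p) rho p (m * (a + b) + c) * rho p (m * (a + b') + c)
    = (p%:R - 1) + p%:R * (b == b' %[mod p])%:R.
Proof.
move=> pm; have e b0 : \sum_(0 <= a < p) leg p (m * (a + b0) + c) = 0.
  by rewrite -[RHS](sum_leg_affine (m * b0 + c) pm); apply: eq_bigr => a _; rewrite mulnDr addnA.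
have e1 (x y : int) : (1 + x) * (1 + y) = 1 + x + y + x * y by ring.
under eq_bigr => a _ do rewrite /rho e1.
rewrite !big_split /= !e leg_correlation // !addr0.
rewrite big_const_nat subn0 iter_addr addr0; lia.
Qed.

Lemma rho_square n : rho p n != 0 -> exists x, (x ^ 2 = n %[mod p])%N.
Proof.
rewrite /rho; case: (legP n) => [] [pn ln]; rewrite ln // => _.
  by exists 0%N; rewrite (eqP pn) mod0n.
have [y e] := chi_residue p_pr p_odd ln; exists (val y); apply/eqP.
by rewrite -Fp_nat_eq // natrX natr_Zp e.
Qed.
End Legendre.

(** * Moments of products of Legendre symbols *)
(** By the Chinese remainder theorem, a -> (a mod m, a mod n) is a bijection onto the pairs of
    residues. *)
Lemma sum_coprime_mul (R : comNzRingType) (m n : nat) (g h : nat -> R) :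
  (0 < m)%N -> (0 < n)%N -> coprime m n ->
  (forall a, g (a %% m)%N = g a) -> (forall a, h (a %% n)%N = h a) ->
  \sum_(0 <= a < m * n) g a * h a = (\sum_(0 <= a < m) g a) * (\sum_(0 <= a < n) h a).
Proof.
move=> m0 n0 co_mn gm hn; rewrite !big_mkord big_distrlr /= pair_big /=.
pose phi (a : 'I_(m * n)) := (Ordinal (ltn_pmod a m0), Ordinal (ltn_pmod a n0)).
have phi_inj : injective phi.
  move=> a b [eqm eqn]; apply: val_inj => /=.
  rewrite -(modn_small (ltn_ord a)) -(modn_small (ltn_ord b)).
  by apply/eqP; rewrite chinese_remainder // eqm eqn !eqxx.
rewrite [RHS](reindex phi); last first.
  by apply: onW_bij; apply: inj_card_bij => //; rewrite card_prod !card_ord.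
by apply: eq_bigr => a _ /=; rewrite gm hn.
Qed.

Lemma coprime_prod_primes (P : seq nat) (p : nat) :
  prime p -> all prime P -> p \notin P -> coprime p (\prod_(q <- P) q).
Proof.
move=> p_pr; elim: P => [|q P IH] /=; first by rewrite big_nil coprimen1.
case/andP=> q_pr P_pr; rewrite inE negb_or => /andP[neq_pq pP].
by rewrite big_cons coprimeMr IH // prime_coprime // dvdn_prime2 // neq_pq.
Qed.

Lemma prod_primes_gt0 (P : seq nat) : all prime P -> (0 < \prod_(q <- P) q)%N.
Proof. by move=> /allP P_pr; rewrite big_seq prodn_cond_gt0 // => q /P_pr /prime_gt0. Qed.

Lemma prod_periodic (R : comNzRingType) (P : seq nat) (f : nat -> nat -> R) (a : nat) :
  (forall p b, p \in P -> f p (b %% p)%N = f p b) ->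
  \prod_(p <- P) f p (a %% \prod_(q <- P) q)%N = \prod_(p <- P) f p a.
Proof.
move=> fP; rewrite [LHS]big_seq [RHS]big_seq; apply: eq_bigr => p pP.
rewrite -fP // modn_dvdm ?fP //.
by rewrite (big_rem p) //= dvdn_mulr.
Qed.

Lemma sum_prod_coprime (R : comNzRingType) (P : seq nat) (f : nat -> nat -> R) :
  uniq P -> all prime P -> (forall p a, p \in P -> f p (a %% p)%N = f p a) ->
  \sum_(0 <= a < \prod_(p <- P) p) \prod_(p <- P) f p a
    = \prod_(p <- P) \sum_(0 <= a < p) f p a.
Proof.
elim: P => [|p P IH] /=; first by rewrite !big_nil big_nat1 big_nil.
case/andP=> pP uP /andP[p_pr P_pr] fP.
have fP' q a : q \in P -> f q (a %% q)%N = f q a by move=> qP; apply: fP; rewrite inE qP orbT.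
rewrite !big_cons -IH //.
under eq_bigr do rewrite big_cons.
apply: sum_coprime_mul.
- exact: prime_gt0.
- exact: prod_primes_gt0.
- exact: coprime_prod_primes.
- by move=> a; apply: fP; rewrite inE eqxx.
- by move=> a; apply: prod_periodic.
Qed.

Lemma modn_add_affine (p m c a b : nat) :
  (m * (a %% p + b) + c = m * (a + b) + c %[mod p])%N.
Proof. by apply/eqP; rewrite eqn_modDr -modnMmr modnDml modnMmr. Qed.

Lemma wt_mul_wt (P : seq nat) (u v : nat) : wt P u * wt P v = \prod_(p <- P) (rho p u * rho p v).
Proof. by rewrite big_split. Qed.

Lemma jac_mul_jac (P : seq nat) (u v : nat) : jac P u * jac P v = \prod_(p <- P) (leg p u * leg p v).
Proof. by rewrite big_split. Qed.

Section Moments.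
Variables (P : seq nat) (m : nat).
Hypotheses (P_uniq : uniq P) (P_prime : all prime P) (P_odd : all odd P).
Hypothesis (P_m : {in P, forall p, ~~ (p %| m)%N}).

Let pr p : p \in P -> prime p. Proof. exact: (allP P_prime). Qed.
Let od p : p \in P -> odd p. Proof. exact: (allP P_odd). Qed.

Lemma sum_wt_affine c : \sum_(0 <= a < \prod_(p <- P) p) wt P (m * a + c) = (\prod_(p <- P) p)%:R.
Proof.
rewrite (sum_prod_coprime (f := fun p a => rho p (m * a + c))) //.
  by rewrite natr_prod [LHS]big_seq [RHS]big_seq; apply: eq_bigr => p pP; rewrite sum_rho_affine ?pr ?od ?P_m.
move=> p a pP; rewrite -rho_mod ?pr // -[in RHS]rho_mod ?pr //.
by have := modn_add_affine p m c a 0; rewrite !addn0 => ->.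
Qed.

Lemma wt_correlation c b b' :
  \sum_(0 <= a < \prod_(p <- P) p) wt P (m * (a + b) + c) * wt P (m * (a + b') + c)
    = \prod_(p <- P) ((p%:R - 1) + p%:R * (b == b' %[mod p])%:R).
Proof.
rewrite (eq_bigr _ (fun a _ => wt_mul_wt P (m * (a + b) + c) (m * (a + b') + c))).
rewrite (sum_prod_coprime (f := fun p a => rho p (m * (a + b) + c) * rho p (m * (a + b') + c))) //.
  by rewrite [LHS]big_seq [RHS]big_seq; apply: eq_bigr => p pP; rewrite rho_correlation ?pr ?od ?P_m.
move=> p a pP; congr (_ * _); rewrite -rho_mod ?pr // modn_add_affine rho_mod ?pr //.
Qed.

Lemma jac_correlation c b b' :
  \sum_(0 <= a < \prod_(p <- P) p) jac P (m * (a + b) + c) * jac P (m * (a + b') + c)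
    = \prod_(p <- P) (p%:R * (b == b' %[mod p])%:R - 1).
Proof.
rewrite (eq_bigr _ (fun a _ => jac_mul_jac P (m * (a + b) + c) (m * (a + b') + c))).
rewrite (sum_prod_coprime (f := fun p a => leg p (m * (a + b) + c) * leg p (m * (a + b') + c))) //.
  by rewrite [LHS]big_seq [RHS]big_seq; apply: eq_bigr => p pP; rewrite leg_correlation ?pr ?od ?P_m.
by move=> p a pP; congr (_ * _); apply: leg_eqmod; rewrite ?pr // modn_add_affine.
Qed.

End Moments.

(** * Variance in short intervals *)

Lemma sum_periodic (f : nat -> int) (g k : nat) : (forall a, f (a + g)%N = f a) ->
  \sum_(0 <= a < k * g) f a = k%:R * \sum_(0 <= a < g) f a.
Proof.
move=> fg; elim: k => [|k IH]; first by rewrite mul0n big_geq // mul0r.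
rewrite mulSn (@big_cat_nat _ _ _ g) ?leq_addr //= -{2}[g]add0n big_addn addKn.
by under [X in _ + X]eq_bigr do rewrite fg; rewrite IH -natr1; ring.
Qed.

(** Each [b] has at most B/g + 1 partners: the range of [b'] is enlarged to whole periods, each
    containing exactly one. *)
Lemma count_congruent (B g : nat) : (0 < g)%N ->
  g%:R * \sum_(0 <= b < B) \sum_(0 <= b' < B) (b == b' %[mod g])%:R <= (B%:R * (B%:R + g%:R) : int).
Proof.
move=> g0; rewrite mulr_sumr.
have one b : \sum_(0 <= b' < g) (b == b' %[mod g])%:R = 1 :> int.
  rewrite big_mkord (bigD1 (Ordinal (ltn_pmod b g0))) //= modn_mod eqxx big1 ?addr0 // => i.
  by rewrite -val_eqE /= (modn_small (ltn_ord i)) eq_sym => /negbTE ->.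
have bound b : g%:R * \sum_(0 <= b' < B) (b == b' %[mod g])%:R <= B%:R + g%:R :> int.
  have le1 : \sum_(0 <= b' < B) (b == b' %[mod g])%:R
      <= \sum_(0 <= b' < (B %/ g).+1 * g) (b == b' %[mod g])%:R :> int.
    rewrite [X in _ <= X](@big_cat_nat _ _ _ B) //=; last by rewrite ltnW // ltn_ceil.
    by rewrite lerDl sumr_ge0.
  rewrite (sum_periodic (f := fun b' => (b == b' %[mod g])%:R)) in le1; last by move=> a; rewrite modnDr.
  rewrite one mulr1 in le1.
  have := leq_trunc_div B g; nia.
apply: (le_trans (ler_sum _ (fun b _ => bound b))).
by rewrite sumr_const_nat subn0 mulr_natl.
Qed.

(** Expanding the product imposes b = b' modulo each subset of [P]. The induction carries the
    modulus [g] imposed so far: the term x p keeps it, the other replaces it by p g. The main terms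
    of [count_congruent] add up to the first product, and each of the 2^|P| error terms costs at
    most the product of [P] times [B], because x p <= p. *)
Lemma kernel_sum_le (P : seq nat) (x : nat -> int) (B g : nat) :
  uniq P -> all prime P -> {in P, forall p, 0 <= x p /\ x p + 1 <= p%:R} ->
  (0 < g)%N -> {in P, forall p, coprime p g} ->
  g%:R * \sum_(0 <= b < B) \sum_(0 <= b' < B)
     (b == b' %[mod g])%:R * \prod_(p <- P) (x p + p%:R * (b == b' %[mod p])%:R)
  <= \prod_(p <- P) (x p + 1) * B%:R ^+ 2 + 2 ^+ size P * (\prod_(p <- P) p)%:R * g%:R * B%:R.
Proof.
elim: P g => [|p P IH] g /=.
  move=> _ _ _ g0 _; under eq_bigr do under eq_bigr do rewrite big_nil mulr1.
  apply: (le_trans (count_congruent B g0)); rewrite !big_nil expr0.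
  by rewrite -subr_ge0; rewrite le_eqVlt; apply/orP; left; apply/eqP; ring.
case/andP=> pP uP /andP[p_pr P_pr] xP g0 coPg.
have xP' : {in P, forall p, 0 <= x p /\ x p + 1 <= p%:R} by move=> q qP; apply: xP; rewrite inE qP orbT.
have co1 : {in P, forall q, coprime q g} by move=> q qP; apply: coPg; rewrite inE qP orbT.
have copg : coprime p g by apply: coPg; rewrite inE eqxx.
have co2 : {in P, forall q, coprime q (p * g)}.
  move=> q qP; have q_pr : prime q := allP P_pr q qP.
  rewrite coprimeMr co1 // andbT prime_coprime // dvdn_prime2 //.
  by apply: contraNneq pP => <-.
have [x0 xp] := xP p (mem_head _ _).
have pg0 : (0 < p * g)%N by rewrite muln_gt0 prime_gt0.
have I1 := IH g uP P_pr xP' g0 co1.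
have I2 := IH (p * g)%N uP P_pr xP' pg0 co2.
set S1 := \sum_(0 <= b < B) _ in I1; set S2 := \sum_(0 <= b < B) _ in I2.
have -> : \sum_(0 <= b < B) \sum_(0 <= b' < B) (b == b' %[mod g])%:R *
     \prod_(q <- p :: P) (x q + q%:R * (b == b' %[mod q])%:R) = x p * S1 + p%:R * S2.
  rewrite !mulr_sumr -big_split /=; apply: eq_bigr => b _.
  rewrite !mulr_sumr -big_split /=; apply: eq_bigr => b' _.
  rewrite big_cons chinese_remainder // -mulnb natrM; ring.
rewrite !big_cons /= [2 ^+ _.+1]exprS natrM; move: I1 I2; rewrite natrM.
set X := \prod_(q <- P) _; set D := (\prod_(q <- P) q)%:R; set K := 2 ^+ size P.
have E0 : 0 <= K * D * g%:R * B%:R by rewrite !mulr_ge0 // exprn_ge0.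
move: (B%:R ^+ 2) => B2 I1 I2.
rewrite -subr_ge0 in I1; rewrite -subr_ge0 in I2.
have J1 := mulr_ge0 x0 I1.
(* The two error terms carry the factors x p and p, together at most 2 p. *)
have J2 : 0 <= (p%:R - x p) * (K * D * g%:R * B%:R) by apply: mulr_ge0 => //; lia.
have J := addr_ge0 J1 (addr_ge0 I2 J2); rewrite -subr_ge0.
by apply: (le_trans J); rewrite le_eqVlt; apply/orP; left; apply/eqP; ring.
Qed.

(** Cauchy-Schwarz, from the nonnegativity of the sum of (f a - f b)^2 over all pairs. *)
Lemma sqr_sum_le (f : nat -> int) (A : nat) :
  (\sum_(0 <= a < A) f a) ^+ 2 <= A%:R * \sum_(0 <= a < A) f a ^+ 2.
Proof.
have : 0 <= \sum_(0 <= a < A) \sum_(0 <= b < A) (f a - f b) ^+ 2.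
  by apply: sumr_ge0 => a _; apply: sumr_ge0 => b _; exact: sqr_ge0.
have -> : \sum_(0 <= a < A) \sum_(0 <= b < A) (f a - f b) ^+ 2
    = 2 * (A%:R * \sum_(0 <= a < A) f a ^+ 2) - 2 * (\sum_(0 <= a < A) f a) ^+ 2.
  have e a : \sum_(0 <= b < A) (f a - f b) ^+ 2
     = A%:R * f a ^+ 2 - 2 * f a * (\sum_(0 <= b < A) f b) + \sum_(0 <= b < A) f b ^+ 2.
    rewrite mulr_sumr -sumrN.
    have -> : A%:R * f a ^+ 2 = \sum_(0 <= b < A) f a ^+ 2 by rewrite sumr_const_nat subn0 mulr_natl.
    by rewrite -!big_split /=; apply: eq_bigr => b _; ring.
  rewrite (eq_bigr _ (fun a _ => e a)) !big_split /= -mulr_sumr sumrN -mulr_suml -mulr_sumr.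
  by rewrite sumr_const_nat subn0 -[_ *+ A]mulr_natl; ring.
lia.
Qed.

Section ShortSums.
Variables (P : seq nat) (m c : nat).
Hypotheses (P_uniq : uniq P) (P_prime : all prime P) (P_odd : all odd P).
Hypothesis (P_m : {in P, forall p, ~~ (p %| m)%N}).
Local Notation D := (\prod_(p <- P) p)%N.

Let pr p : p \in P -> prime p. Proof. exact: (allP P_prime). Qed.

Lemma sum_sqr_short (f : nat -> int) (A B : nat) :
  \sum_(0 <= a < A) (\sum_(0 <= b < B) f (a + b)%N) ^+ 2
  = \sum_(0 <= b < B) \sum_(0 <= b' < B) \sum_(0 <= a < A) f (a + b)%N * f (a + b')%N.
Proof.
rewrite (eq_bigr (fun a => \sum_(0 <= b < B) \sum_(0 <= b' < B) f (a + b)%N * f (a + b')%N)); last first.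
  by move=> a _; rewrite expr2 big_distrlr.
by rewrite exchange_big_nat; apply: eq_bigr => b _; rewrite exchange_big_nat.
Qed.

(** The mean over a full period is exactly [B], so the main term D B^2 of [kernel_sum_le], applied
    with x p = p - 1, cancels and only its error term remains. *)
Lemma wt_variance (B : nat) :
  \sum_(0 <= a < D) (\sum_(0 <= b < B) wt P (m * (a + b) + c) - B%:R) ^+ 2
  <= 2 ^+ size P * D%:R * B%:R.
Proof.
pose W a := \sum_(0 <= b < B) wt P (m * (a + b) + c).
have s1 : \sum_(0 <= a < D) W a = B%:R * D%:R.
  rewrite exchange_big_nat /=.
  have e b : \sum_(0 <= a < D) wt P (m * (a + b) + c) = D%:R.
    rewrite -(sum_wt_affine P_uniq P_prime P_odd P_m (m * b + c)).
    by apply: eq_bigr => a _; rewrite mulnDr addnA.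
  by rewrite (eq_bigr _ (fun b _ => e b)) sumr_const_nat subn0 mulr_natl.
have s2 : \sum_(0 <= a < D) W a ^+ 2 <= D%:R * B%:R ^+ 2 + 2 ^+ size P * D%:R * B%:R.
  rewrite (sum_sqr_short (fun n => wt P (m * n + c))).
  have := @kernel_sum_le P (fun p => p%:R - 1) B 1 P_uniq P_prime.
  have -> : \prod_(p <- P) (p%:R - 1 + 1) = D%:R :> int.
    by rewrite natr_prod; apply: eq_bigr => p _; rewrite subrK.
  rewrite mul1r mulr1 => K; apply: le_trans (K _ _ _) => //; last by move=> p _; rewrite coprimen1.
    apply: ler_sum => b _; apply: ler_sum => b' _.
    by rewrite !modn1 eqxx mul1r (wt_correlation P_uniq P_prime P_odd P_m).
  by move=> p /pr /prime_gt0; lia.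
have -> : \sum_(0 <= a < D) (W a - B%:R) ^+ 2
   = \sum_(0 <= a < D) W a ^+ 2 - 2 * B%:R * (\sum_(0 <= a < D) W a) + D%:R * B%:R ^+ 2.
  rewrite mulr_sumr -sumrN.
  have -> : D%:R * B%:R ^+ 2 = \sum_(0 <= a < D) B%:R ^+ 2 :> int by rewrite sumr_const_nat subn0 mulr_natl.
  by rewrite -!big_split /=; apply: eq_bigr => b _; ring.
rewrite s1; move: s2; set T := \sum_(0 <= a < D) _ => s2.
have -> : T - 2 * B%:R * (B%:R * D%:R) + D%:R * B%:R ^+ 2 = T - D%:R * B%:R ^+ 2 by ring.
by rewrite lerBlDl.
Qed.

(** The correlation factor at [p] is at most 1 + p [b = b' mod p] in absolute value, so
    [kernel_sum_le] applies with x = 1. *)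
Lemma jac_variance (B : nat) :
  \sum_(0 <= a < D) (\sum_(0 <= b < B) jac P (m * (a + b) + c)) ^+ 2
  <= 2 ^+ size P * B%:R ^+ 2 + 2 ^+ size P * D%:R * B%:R.
Proof.
rewrite (sum_sqr_short (fun n => jac P (m * n + c))).
have := @kernel_sum_le P (fun p => 1) B 1 P_uniq P_prime.
rewrite mul1r mulr1.
have -> : \prod_(p <- P) (1 + 1) = 2 ^+ size P :> int by rewrite big_const_seq count_predT iter_mulr mulr1.
move=> K; apply: le_trans (K _ _ _) => //; last by move=> p _; rewrite coprimen1.
  apply: ler_sum => b _; apply: ler_sum => b' _.
  rewrite !modn1 eqxx mul1r (jac_correlation P_uniq P_prime P_odd P_m).
  apply: (le_trans (ler_norm _)); rewrite normr_prod.
  rewrite big_seq [X in _ <= X]big_seq; apply: ler_prod => p /pr /prime_gt0 p0.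
  by rewrite normr_ge0; case: eqP => _; lia.
by move=> p /pr /prime_gt1; lia.
Qed.

(** Cauchy-Schwarz over the first [A] values; their squares are part of the sum over a full
    period. *)
Lemma short_deviation (f : nat -> int) (A : nat) (V : int) : (A <= D)%N ->
  \sum_(0 <= a < D) f a ^+ 2 <= V -> (\sum_(0 <= a < A) f a) ^+ 2 <= A%:R * V.
Proof.
move=> AD fV; apply: (le_trans (sqr_sum_le f A)); apply: ler_wpM2l => //.
apply: le_trans fV; rewrite [X in _ <= X](@big_cat_nat _ _ _ A) //=.
by rewrite lerDl sumr_ge0 // => a _; exact: sqr_ge0.
Qed.

Lemma wt_double_sum_deviation (A B : nat) : (A <= D)%N ->
  (\sum_(0 <= a < A) \sum_(0 <= b < B) wt P (m * (a + b) + c) - A%:R * B%:R) ^+ 2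
  <= A%:R * (2 ^+ size P * D%:R * B%:R).
Proof.
move=> AD; have := short_deviation AD (wt_variance B).
by rewrite sumrB sumr_const_nat subn0 -[_ *+ A]mulr_natl.
Qed.

(** The size hypothesis makes the squared deviation at most (A B)^2 / 4, so at least half of the
    expected value A B remains. *)
Lemma wt_double_sum_lower (A B : nat) : (A <= D)%N -> (4 * 2 ^ size P * D <= A * B)%N ->
  A%:R * B%:R <= 2 * \sum_(0 <= a < A) \sum_(0 <= b < B) wt P (m * (a + b) + c).
Proof.
move=> AD big; have := wt_double_sum_deviation B AD.
set S := \sum_(0 <= a < A) _; move: big; rewrite -(ler_nat int) !natrM natrX.
set K := 2 ^+ _; set M := D%:R; set a := A%:R; set b := B%:R => big dev.
rewrite leNgt; apply/negP => lt.
have a0 : 0 <= a * b by rewrite mulr_ge0.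
have le1 : a * (K * M * b) <= (a * b) * (K * M) by rewrite le_eqVlt; apply/orP; left; apply/eqP; ring.
rewrite -mulrA in big.
move: (a * b) (K * M) (le_trans dev le1) lt a0 big => t k dev1 lt t0 big.
have h1 := ler_wpM2l t0 big.
have h2 : 0 < (t - 2 * S) * (3 * t - 2 * S) by apply: mulr_gt0; lia.
have e : (t - 2 * S) * (3 * t - 2 * S) = 4 * (S - t) ^+ 2 - t * t by ring.
lia.
Qed.

Lemma wt_double_sum_upper (A B : nat) : (A <= D)%N -> (2 ^ size P * D <= A * B)%N ->
  \sum_(0 <= a < A) \sum_(0 <= b < B) wt P (m * (a + b) + c) <= 2 * (A%:R * B%:R).
Proof.
move=> AD big; have := wt_double_sum_deviation B AD.
set S := \sum_(0 <= a < A) _; move: big; rewrite -(ler_nat int) !natrM natrX.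
set K := 2 ^+ _; set M := D%:R; set a := A%:R; set b := B%:R => big dev.
rewrite leNgt; apply/negP => lt.
have a0 : 0 <= a * b by rewrite mulr_ge0.
have le1 : a * (K * M * b) <= (a * b) * (K * M) by rewrite le_eqVlt; apply/orP; left; apply/eqP; ring.
move: (a * b) (K * M) (le_trans dev le1) lt a0 big => t k dev1 lt t0 big.
have h1 := ler_wpM2l t0 big.
have h2 : 0 < (S - 2 * t) * S by apply: mulr_gt0; lia.
have e : (S - 2 * t) * S = (S - t) ^+ 2 - t * t by ring.
lia.
Qed.

Lemma jac_double_sum (A B : nat) : (A <= D)%N -> (B <= D)%N ->
  (\sum_(0 <= a < A) \sum_(0 <= b < B) jac P (m * (a + b) + c)) ^+ 2
  <= A%:R * B%:R * (2 * 2 ^+ size P * D%:R).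
Proof.
move=> AD BD; apply: (le_trans (short_deviation AD (jac_variance B))).
have : 0 <= A%:R * 2 ^+ size P * B%:R * (D%:R - B%:R) :> int.
  by rewrite !mulr_ge0 // ?exprn_ge0 // subr_ge0 ler_nat.
rewrite -(subr_ge0 (A%:R * _)) => h; apply: (le_trans h).
by rewrite le_eqVlt; apply/orP; left; apply/eqP; ring.
Qed.

Lemma wt_ge0 n : 0 <= wt P n.
Proof. by rewrite /wt big_seq; apply: prodr_ge0 => p pP; rewrite rho_ge0 ?pr. Qed.

Lemma wt_periodic k n : wt P (n + k * D) = wt P n.
Proof.
rewrite /wt [LHS]big_seq [RHS]big_seq; apply: eq_bigr => p pP.
rewrite -rho_mod ?pr // -[RHS]rho_mod ?pr //; congr (rho p _).
have /dvdnP[e ->] : (p %| D)%N by rewrite (big_rem p) //= dvdn_mulr.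
by rewrite addnC mulnA modnMDl.
Qed.

End ShortSums.

(** Together with [double_sum_ge], this passes between the smoothed double sums, which the variance
    controls, and plain sums over an interval. *)
Lemma double_sum_le (f : nat -> int) (H : nat) : (forall n, 0 <= f n) ->
  \sum_(0 <= a < H) \sum_(0 <= b < H) f (a + b)%N <= H%:R * \sum_(0 <= s < 2 * H) f s.
Proof.
move=> f0; rewrite exchange_big_nat /=.
have e b : (b < H)%N -> \sum_(0 <= a < H) f (a + b)%N <= \sum_(0 <= s < 2 * H) f s.
  move=> bH; have -> : \sum_(0 <= a < H) f (a + b)%N = \sum_(b <= s < b + H) f s.
    by rewrite -{2}[b]add0n big_addn addKn.
  rewrite [X in _ <= X](@big_cat_nat _ _ _ b) /=; try lia.
  rewrite [X in _ <= _ + X](@big_cat_nat _ _ _ (b + H)) /=; try lia.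
  by rewrite addrCA lerDl addr_ge0 // sumr_ge0.
rewrite -[H in H%:R]subn0 mulr_natl -sumr_const_nat.
by apply: ler_sum_nat => b /andP[_ bH]; apply: e.
Qed.

(** For every b < X the window from b to b + 2 X contains the interval from X to 2 X. *)
Lemma double_sum_ge (f : nat -> int) (X : nat) : (forall n, 0 <= f n) ->
  X%:R * \sum_(0 <= s < X) f (s + X)%N <= \sum_(0 <= a < 2 * X) \sum_(0 <= b < X) f (a + b)%N.
Proof.
move=> f0; rewrite exchange_big_nat /= -[X in X%:R]subn0 mulr_natl -sumr_const_nat.
apply: ler_sum_nat => b /andP[_ bX].
have -> : \sum_(0 <= a < 2 * X) f (a + b)%N = \sum_(b <= s < b + 2 * X) f s.
  by rewrite -{2}[b]add0n big_addn addKn.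
have -> : \sum_(0 <= s < X) f (s + X)%N = \sum_(X <= s < 2 * X) f s.
  by have := big_addn 0 (2 * X) X xpredT f; rewrite add0n => ->; rewrite mul2n -addnn addnK.
rewrite [X in _ <= X](@big_cat_nat _ _ _ X) /=; try lia.
rewrite [X in _ <= _ + X](@big_cat_nat _ _ _ (2 * X)) /=; try lia.
by rewrite addrCA lerDl addr_ge0 // sumr_ge0.
Qed.

(** * The weight of a residue in terms of Legendre symbols *)
Lemma wt_sum_lower (P : seq nat) (m c H : nat) :
  uniq P -> all prime P -> all odd P -> {in P, forall p, ~~ (p %| m)%N} ->
  (H <= \prod_(p <- P) p)%N -> (4 * 2 ^ size P * \prod_(p <- P) p <= H * H)%N ->
  H%:R <= 2 * \sum_(0 <= s < 2 * H) wt P (m * s + c).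
Proof.
move=> uP pP oP mP HD big.
have h1 := wt_double_sum_lower c uP pP oP mP HD big.
have h2 := double_sum_le H (fun n => wt_ge0 pP (m * n + c)%N).
have [->|H0] := posnP H; first by rewrite big_geq.
rewrite -(ler_pM2l (x := H%:R)) ?ltr0n //.
by apply: (le_trans h1); move: h2; rewrite mulrCA => h2; rewrite ler_pM2l.
Qed.

Lemma wt_sum_upper (P : seq nat) (m X : nat) :
  uniq P -> all prime P -> all odd P -> {in P, forall p, ~~ (p %| m)%N} ->
  (2 * X <= \prod_(p <- P) p)%N -> (2 ^ size P * \prod_(p <- P) p <= 2 * X * X)%N ->
  \sum_(0 <= s < X) wt P (m * s) <= 4 * X%:R.
Proof.
move=> uP pP oP mP XD big; set D := (\prod_(p <- P) p)%N in XD big.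
have D0 : (0 < D)%N by exact: prod_primes_gt0.
(* With this offset, m (s + X) + m X (D - 1) = m s + (m X) D, and periodicity brings the interval
   from X to 2 X back to the one from 0 to X. *)
have h1 := wt_double_sum_upper (m * X * D.-1) uP pP oP mP XD big.
have h2 := double_sum_ge X (fun n => wt_ge0 pP (m * n + m * X * D.-1)%N).
have [->|X0] := posnP X; first by rewrite big_geq.
rewrite -(ler_pM2l (x := X%:R)) ?ltr0n //.
have e s : wt P (m * (s + X) + m * X * D.-1) = wt P (m * s).
  rewrite -(wt_periodic pP (m * X) (m * s)) -/D; congr (wt P _).
  by case: (D) D0 => // n _ /=; lia.
rewrite -(eq_bigr _ (fun s _ => e s)); apply: (le_trans h2); apply: (le_trans h1).
by rewrite natrM le_eqVlt; apply/orP; left; apply/eqP; ring.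
Qed.

(** These are the odd primes of [d] modulo which a progression of difference [m] runs through all
    residues. *)
Definition odd_primes_off (d m : nat) : seq nat := [seq p <- primes d | odd p && ~~ (p %| m)%N].

Section OddPrimesOff.
Variables (d m : nat).
Local Notation P := (odd_primes_off d m).

Lemma mem_odd_primes_off p :
  (p \in P) = [&& odd p, ~~ (p %| m)%N & p \in primes d].
Proof. by rewrite mem_filter andbA. Qed.

Lemma uniq_odd_primes_off : uniq P.
Proof. by rewrite filter_uniq ?primes_uniq. Qed.

Lemma prime_odd_primes_off : all prime P.
Proof. by apply/allP => p; rewrite mem_odd_primes_off mem_primes => /and3P[_ _ /and3P[]]. Qed.

Lemma odd_odd_primes_off : all odd P.
Proof. by apply/allP => p; rewrite mem_odd_primes_off => /and3P[]. Qed.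

Lemma ndvd_odd_primes_off : {in P, forall p, ~~ (p %| m)%N}.
Proof. by move=> p; rewrite mem_odd_primes_off => /and3P[]. Qed.

Lemma size_odd_primes_off : (size P <= omega d)%N.
Proof. by rewrite size_filter count_size. Qed.

End OddPrimesOff.

Lemma prod_primes_dvd (P : seq nat) (n : nat) :
  uniq P -> all prime P -> {in P, forall p, (p %| n)%N} -> (\prod_(p <- P) p %| n)%N.
Proof.
elim: P => [|p P IH] /=; first by rewrite big_nil dvd1n.
case/andP=> pP uP /andP[p_pr P_pr] dvP; rewrite big_cons Gauss_dvd; last exact: coprime_prod_primes.
by rewrite dvP ?mem_head // IH // => q qP; apply: dvP; rewrite inE qP orbT.
Qed.

Lemma prod_odd_primes_off_le (d m : nat) : (0 < d)%N -> (\prod_(p <- odd_primes_off d m) p <= d)%N.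
Proof.
move=> d0; apply: dvdn_leq => //; apply: prod_primes_dvd.
- exact: uniq_odd_primes_off.
- exact: prime_odd_primes_off.
by move=> p; rewrite mem_odd_primes_off mem_primes => /and3P[_ _ /and3P[]].
Qed.

Lemma squarefree_prod_primes (d : nat) : (0 < d)%N -> squarefree d -> (\prod_(p <- primes d) p)%N = d.
Proof.
move=> d0 sf; rewrite [RHS]prod_prime_decomp // prime_decompE big_map /=.
rewrite big_seq [RHS]big_seq; apply: eq_bigr => p pd.
have : (0 < logn p d)%N by rewrite logn_gt0.
have p_pr : prime p by move: pd; rewrite mem_primes => /and3P[].
have := sf p p_pr; rewrite -[(p * p)%N]/(p ^ 2)%N pfactor_dvdn // -ltnNge.
by case: (logn p d) => [|[|]] //; rewrite expn1.
Qed.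

(** The primes left out are distinct and all divide [n], hence so does their product. *)
Lemma squarefree_le_odd_primes_off (d m n : nat) : (0 < d)%N -> (0 < n)%N -> squarefree d ->
  {in primes d, forall p, odd p -> (p %| m)%N -> (p %| n)%N} -> odd d || (2 %| n)%N ->
  (d <= n * \prod_(p <- odd_primes_off d m) p)%N.
Proof.
move=> d0 n0 sf mn d2; rewrite -{1}(squarefree_prod_primes d0 sf) mulnC.
rewrite (bigID (fun p => odd p && ~~ (p %| m)%N)) /= big_filter leq_mul2l.
apply/orP; right; apply: dvdn_leq => //.
rewrite -big_filter; apply: prod_primes_dvd.
- by rewrite filter_uniq ?primes_uniq.
- by apply/allP => p; rewrite mem_filter mem_primes => /andP[_ /and3P[]].
move=> p; rewrite mem_filter => /andP[pm pd]; move: (pd); rewrite mem_primes => /and3P[p_pr _ dvd_pd].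
have [p2|po] := even_prime p_pr; last by apply: mn => //; move: pm; rewrite po negbK.
by move: d2; rewrite -p2 => /orP[od|//]; move: dvd_pd; rewrite p2 dvdn2 od.
Qed.

Lemma wt_odd_primes_off (d m r : nat) :
  {in primes d, forall p, odd p -> (p %| m)%N -> (p %| r)%N} ->
  wt (odd_primes_off d 1) r = wt (odd_primes_off d m) r.
Proof.
move=> mr; rewrite /wt !big_filter big_seq_cond [RHS]big_seq_cond.
rewrite (bigID (fun p => p %| m)%N) /= big1 ?mul1r.
  apply: eq_bigl => p; rewrite dvdn1; case: (boolP (p \in primes d)) => //= pd.
  move: pd; rewrite mem_primes => /and3P[/prime_gt1 p1 _ _]. have -> : (p == 1)%N = false by lia. by rewrite andbT.
move=> p /andP[/andP[pd /andP[op _]] pm]; apply: rho_dvd; last exact: mr.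
by move: pd; rewrite mem_primes => /and3P[].
Qed.

Lemma omega_gcd (d r : nat) : (0 < d)%N -> (0 < r)%N ->
  (omega d - omega (gcdn d r))%N = count (fun p => ~~ (p %| r)%N) (primes d).
Proof.
move=> d0 r0; rewrite /omega -(count_predC (fun p => p %| r)%N (primes d)).
have -> : size (primes (gcdn d r)) = count (fun p => p %| r)%N (primes d).
  rewrite -size_filter; apply: perm_size; apply: uniq_perm.
  - exact: primes_uniq.
  - by rewrite filter_uniq ?primes_uniq.
  move=> p; rewrite mem_filter !mem_primes gcdn_gt0 d0 dvdn_gcd /=.
  by case: (prime p); case: (p %| d)%N; case: (p %| r)%N.
by rewrite addKn.
Qed.

(** By [omega_gcd] the right side is a product of 2 over the primes of [d] not dividing [r]; there
    rho <= 2, while rho = 1 at the odd primes dividing [r]. *)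
Lemma wt_le_weight (d r : nat) : (0 < d)%N -> (0 < r)%N ->
  wt (odd_primes_off d 1) r <= (2 ^ (omega d - omega (gcdn d r)))%:R.
Proof.
move=> d0 r0; rewrite omega_gcd // natrX.
have -> : 2 ^+ count (fun p => ~~ (p %| r)%N) (primes d) =
    \prod_(p <- primes d) (if (p %| r)%N then 1 else 2) :> int.
  by elim: (primes d) => [|p s IH] /=; rewrite ?big_nil // big_cons -IH exprD; case: ifP.
rewrite /wt big_filter big_mkcond big_seq [X in _ <= X]big_seq; apply: ler_prod => p.
rewrite mem_primes => /and3P[p_pr _ _]; case: ifP => [_|_]; last by case: ifP.
rewrite rho_ge0 //=; case: ifP => pr; first by rewrite rho_dvd.
exact: rho_le2.
Qed.

Lemma square_mod_prod (P : seq nat) (r : nat) : uniq P -> all prime P ->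
  {in P, forall p, exists x, (x ^ 2 = r %[mod p])%N} ->
  exists x, (x ^ 2 = r %[mod \prod_(p <- P) p])%N.
Proof.
elim: P => [|p P IH] /=; first by exists 0%N; rewrite big_nil !modn1.
case/andP=> pP uP /andP[p_pr P_pr] sq; have co := coprime_prod_primes p_pr P_pr pP.
have [x xp] := sq p (mem_head _ _).
have [|y yP] := IH uP P_pr; first by move=> q qP; apply: sq; rewrite inE qP orbT.
exists (chinese p (\prod_(q <- P) q) x y); rewrite big_cons; apply/eqP.
rewrite chinese_remainder // -modnXm chinese_modl // modnXm xp eqxx /=.
by rewrite -modnXm chinese_modr // modnXm yP.
Qed.

Lemma wt_neq0_square (d r : nat) : (0 < d)%N -> squarefree d ->
  wt (odd_primes_off d 1) r != 0 -> is_square_mod d r%:Z.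
Proof.
move=> d0 sf w0.
have [||x xr] := @square_mod_prod (primes d) r (primes_uniq d).
- by apply/allP => p; rewrite mem_primes => /and3P[].
- move=> p pd; have p_pr : prime p by move: pd; rewrite mem_primes => /and3P[].
  have [->|po] := even_prime p_pr.
    by exists r; rewrite !modn2 oddX.
  have pP : p \in odd_primes_off d 1.
    by rewrite mem_odd_primes_off po pd dvdn1 /= andbT; have := prime_gt1 p_pr; lia.
  apply: rho_square => //; apply: contraNneq w0 => e.
  by rewrite /wt (big_rem p) //= e mul0r.
exists x%:Z; rewrite squarefree_prod_primes // in xr.
by rewrite -rmorphXn /= !modz_nat; congr Posz.
Qed.

(** Being a square modulo [d] need not be checked on [S]: where it fails, the weight is 0. What
    remains is to exhibit unrepresented [r] of large total weight. *)
Lemma sum_wt_le_Dsum (d : nat) (S : pred nat) : (0 < d)%N -> squarefree d ->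
  (forall r, S r -> [/\ (0 < r)%N, (4 * r < d)%N & ~ rat_rep d r%:Z]) ->
  \sum_(0 <= r < d | S r) wt (odd_primes_off d 1) r <= (Dsum d)%:R.
Proof.
move=> d0 sf SP; rewrite /Dsum natr_sum big_mkcond [X in _ <= X]big_mkcond /=.
apply: ler_sum => r _; case: ifP => [Sr|_]; last by case: ifP.
have [r0 r4 nr] := SP r Sr.
have [->|w0] := eqVneq (wt (odd_primes_off d 1) r) 0; first by case: ifP.
have -> : in_D d r.
  rewrite /in_D r0 r4 /=; apply/andP; split; first by apply/asboolP; apply: wt_neq0_square.
  exact/asboolP.
exact: wt_le_weight.
Qed.

(** * Local obstructions *)
Lemma rat_rep_int (d : nat) (r : int) : rat_rep d r ->
  exists x y n : int, n != 0 /\ r * n ^+ 2 = x ^+ 2 + d%:Z * y ^+ 2.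
Proof.
case=> a [b e].
exists (numq a * denq b), (numq b * denq a), (denq a * denq b); split.
  by rewrite mulf_neq0 ?denq_neq0.
apply/eqP; rewrite -(eqr_int rat); apply/eqP.
have da : (denq a)%:~R != 0 :> rat by rewrite intr_eq0 denq_neq0.
have db : (denq b)%:~R != 0 :> rat by rewrite intr_eq0 denq_neq0.
have ha : (numq a)%:~R = a * (denq a)%:~R by rewrite -{2}(divq_num_den a) divfK.
have hb : (numq b)%:~R = b * (denq b)%:~R by rewrite -{2}(divq_num_den b) divfK.
by rewrite !(rmorphD, rmorphM, rmorphXn) /= e ha hb -[d%:~R]/(d%:R); ring.
Qed.

Lemma rat_rep_descent (l : int) (d : nat) (r : int) : 1 < l ->
  (forall x y n : int, r * n ^+ 2 = x ^+ 2 + d%:Z * y ^+ 2 ->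
     [/\ (l %| x)%Z, (l %| y)%Z & (l %| n)%Z]) -> ~ rat_rep d r.
Proof.
move=> l1 desc /rat_rep_int[x [y [n [n0 e]]]].
have [k] := ubnP `|n|%N; elim: k x y n n0 e => // k IH x y n n0 e nk.
have [/dvdzP[x' ex] /dvdzP[y' ey] /dvdzP[n' en]] := desc x y n e.
have n'0 : n' != 0 by apply: contraNneq n0 => e'; rewrite en e' mul0r.
apply: (IH x' y' n') => //.
  have l20 : l ^+ 2 != 0 by rewrite expf_neq0 //; lia.
  apply: (mulfI l20); move: e; rewrite ex ey en => e.
  have -> : l ^+ 2 * (r * n' ^+ 2) = r * (n' * l) ^+ 2 by ring.
  by rewrite e; ring.
have n'1 : (0 < `|n'|)%N by rewrite absz_gt0.
have l2 : (1 < `|l|)%N by lia.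
move: nk; rewrite en abszM; nia.
Qed.

Lemma sqr_mod8 (x : int) :
  exists a, (x ^+ 2 = 8 * a + 1) \/ ((2 %| x)%Z /\ (x ^+ 2 = 8 * a \/ x ^+ 2 = 8 * a + 4)).
Proof.
have := divz_eq x 4; have := modz_ge0 x (isT : 4 != 0 :> int); have := ltz_pmod x (isT : 0 < 4 :> int).
move: (x %/ 4)%Z (x %% 4)%Z => k i i4 i0 ->.
have [->|[->|[->|->]]] : i = 0 \/ i = 1 \/ i = 2 \/ i = 3 by lia.
- exists (2 * k ^+ 2); right; split; [by apply/dvdzP; exists (2 * k); ring | left; ring].
- by exists (2 * k ^+ 2 + k); left; ring.
- exists (2 * k ^+ 2 + 2 * k); right; split; [by apply/dvdzP; exists (2 * k + 1); ring | right; ring].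
- by exists (2 * k ^+ 2 + 3 * k + 1); left; ring.
Qed.

(** When d is neither 0 modulo 4 nor 7 modulo 8, this is a class modulo 8 on which the Hilbert
    symbol (r, -d) at 2 equals -1. *)
Definition two_adic_class (d : nat) : nat :=
  if odd d then if (d %% 4 == 1)%N then 3 else 2 else 5.

(** Squares are 0, 1 or 4 modulo 8; running through the cases, the equation modulo 8 forces x, y and
    n to be even, and the descent applies with l = 2. *)
Lemma two_adic_obstruction (d r : nat) : (d %% 4 != 0)%N -> (d %% 8 != 7)%N ->
  (r %% 8 = two_adic_class d)%N -> ~ rat_rep d r%:Z.
Proof.
move=> d4 d7 er; apply: (@rat_rep_descent 2) => // x y n.
have [u [v cases]] : exists u v, [\/ d = 8 * v + 1 /\ r = 8 * u + 3, d = 8 * v + 5 /\ r = 8 * u + 3,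
    d = 8 * v + 3 /\ r = 8 * u + 2 | d = 8 * v + 2 /\ r = 8 * u + 5 \/ d = 8 * v + 6 /\ r = 8 * u + 5]%N.
  exists (r %/ 8)%N, (d %/ 8)%N; move: er; rewrite /two_adic_class.
  have := modn2 d; case: (odd d) => /= o; last by constructor 4; lia.
  case: eqP => d1 er; last by constructor 3; lia.
  have [d8|d8] : (d %% 8 = 1 \/ d %% 8 = 5)%N by lia.
    by constructor 1; lia.
  by constructor 2; lia.
have [a xa] := sqr_mod8 x; have [b yb] := sqr_mod8 y; have [c nc] := sqr_mod8 n.
move: xa yb nc; move: (x ^+ 2) (y ^+ 2) (n ^+ 2) => X Y N.
case=> [->|[x2 [->|->]]]; case=> [->|[y2 [->|->]]]; case=> [->|[n2 [->|->]]] // e; exfalso;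
case: cases => [[ed er']|[ed er']|[ed er']|[[ed er']|[ed er']]]; move: e; rewrite ed er' !(PoszD, PoszM); lia.
Qed.

Lemma intr_Fp_eq0 (q : nat) (z : int) : prime q -> (z%:~R == 0 :> 'F_q) = (q%:Z %| z)%Z.
Proof.
move=> q_pr; rewrite /dvdz; case: z => n; rewrite ?NegzE ?mulrNz ?oppr_eq0 ?abszN /= ?Fp_nat_eq0 //.
Qed.

(** Modulo [q], x^2 = -d y^2 with -d a nonresidue, so q divides x and y. Then q^2 divides the right
    side, and since q does not divide [r] it divides n. *)
Lemma nonresidue_obstruction (q d r : nat) : prime q -> odd q -> chi q (- d%:R) = -1 ->
  ~~ (q %| r)%N -> ~ rat_rep d (q * r)%N%:Z.
Proof.
move=> q_pr q_odd chid qr; apply: (@rat_rep_descent q) => [|x y n e].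
  by rewrite ltz_nat prime_gt1.
have eF : (x%:~R : 'F_q) ^+ 2 = - d%:R * y%:~R ^+ 2.
  have := congr1 (fun z : int => z%:~R : 'F_q) e.
  rewrite PoszM !(rmorphD, rmorphM, rmorphXn) /=.
  have -> : (q%:Z)%:~R = 0 :> 'F_q by apply/eqP; rewrite intr_Fp_eq0 // dvdzz.
  by rewrite !mul0r => /esym/eqP; rewrite addr_eq0 => /eqP ->; rewrite mulNr.
have y0 : y%:~R = 0 :> 'F_q.
  apply/eqP; apply: contraTT isT => y0.
  have : chi q (- d%:R * y%:~R ^+ 2) = -1 by rewrite chiM // chid chi_square // mulr1.
  rewrite -eF; case: (eqVneq (x%:~R : 'F_q) 0) => [->|x0]; first by rewrite expr0n chi0.
  by rewrite chi_square.
have x0 : x%:~R = 0 :> 'F_q by apply/eqP; rewrite -sqrf_eq0 eF y0 expr0n mulr0.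
have qx : (q%:Z %| x)%Z by rewrite -intr_Fp_eq0 // x0.
have qy : (q%:Z %| y)%Z by rewrite -intr_Fp_eq0 // y0.
split=> //; case/dvdzP: qx => x' ex; case/dvdzP: qy => y' ey.
have : (r%:Z * n ^+ 2) = q%:Z * (x' ^+ 2 + d%:Z * y' ^+ 2).
  have q0 : q%:Z != 0 by have := prime_gt0 q_pr; lia.
  by apply: (mulfI q0); rewrite mulrA -PoszM e ex ey; ring.
move/(congr1 (fun z : int => z%:~R : 'F_q))/eqP.
have -> : (q%:Z * (x' ^+ 2 + d%:Z * y' ^+ 2))%:~R = 0 :> 'F_q.
  by apply/eqP; rewrite intr_Fp_eq0 // dvdz_mulr.
rewrite rmorphM rmorphXn /= mulf_eq0 sqrf_eq0 -[_%:~R]/(r%:R) Fp_nat_eq0 // (negbTE qr) /=.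
by rewrite intr_Fp_eq0.
Qed.

(** Here q divides x at once; after division by q, r n^2 = d y^2 modulo q, which for a nonresidue r
    d forces n and y to vanish. *)
Lemma ramified_obstruction (q d r : nat) : prime q -> odd q -> leg q (r * d) = -1 ->
  ~ rat_rep (q * d) (q * r)%N%:Z.
Proof.
move=> q_pr q_odd legrd; apply: (@rat_rep_descent q) => [|x y n e].
  by rewrite ltz_nat prime_gt1.
have q0 : q%:Z != 0 by have := prime_gt0 q_pr; lia.
have qx : (q%:Z %| x)%Z.
  have : x%:~R ^+ 2 == 0 :> 'F_q.
    rewrite -rmorphXn intr_Fp_eq0 //.
    have -> : x ^+ 2 = q%:Z * (r%:Z * n ^+ 2 - d%:Z * y ^+ 2).
      by apply: (addIr ((q * d)%N%:Z * y ^+ 2)); rewrite -e !PoszM; ring.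
    by rewrite dvdz_mulr.
  by rewrite sqrf_eq0 intr_Fp_eq0.
case/dvdzP: (qx) => x' ex.
have e' : r%:Z * n ^+ 2 = q%:Z * x' ^+ 2 + d%:Z * y ^+ 2.
  by apply: (mulfI q0); rewrite mulrA -PoszM e ex PoszM; ring.
have eF : r%:R * n%:~R ^+ 2 = d%:R * y%:~R ^+ 2 :> 'F_q.
  have := congr1 (fun z : int => z%:~R : 'F_q) e'.
  rewrite !(rmorphD, rmorphM, rmorphXn) /=.
  have -> : (q%:Z)%:~R = 0 :> 'F_q by apply/eqP; rewrite intr_Fp_eq0 // dvdzz.
  by rewrite mul0r add0r.
have rd0 : (r%:R * d%:R : 'F_q) != 0.
  by apply: contra_eq_neq legrd => z; rewrite /leg natrM z chi0.
have d0 : d%:R != 0 :> 'F_q by apply: contraNneq rd0 => ->; rewrite mulr0.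
have n0 : n%:~R = 0 :> 'F_q.
  apply/eqP; apply: contraTT isT => n0.
  have : chi q (r%:R * d%:R * n%:~R ^+ 2) = -1.
    by rewrite chiM // chi_square // mulr1 -natrM.
  have -> : r%:R * d%:R * n%:~R ^+ 2 = (d%:R * y%:~R) ^+ 2 :> 'F_q by rewrite mulrAC eF; ring.
  case: (eqVneq (d%:R * y%:~R : 'F_q) 0) => [->|x0]; first by rewrite expr0n chi0.
  by rewrite chi_square.
have : y%:~R ^+ 2 == 0 :> 'F_q by move: eF; rewrite n0 expr0n mulr0 => /esym/eqP; rewrite mulf_eq0 (negbTE d0).
by rewrite sqrf_eq0 => y0; split=> //; rewrite -intr_Fp_eq0 // n0.
Qed.

(** * Quadratic reciprocity *)
Section GaussSum.
Variables (p q : nat) (p_pr : prime p) (p_odd : odd p).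
Variables (A : nzRingType) (chA : q \in [pchar A]) (T : 'F_p -> A).
Hypotheses (T0 : T 0 = 1) (TD : forall x y, T (x + y) = T x * T y).

(** The Gauss sum of an additive character with values in a possibly noncommutative ring of
    characteristic [q]. The complete sum J below is not assumed to vanish; J G = 0 suffices, giving
    G^3 = chi(-1) p G in place of G^2 = chi(-1) p. *)
Let G : A := \sum_x T x *~ chi p x.
Let J : A := \sum_x T x.

Let sum_shift (F : 'F_p -> A) c : \sum_x F (c + x) = \sum_x F x.
Proof. by rewrite [RHS](reindex_inj (addrI c)). Qed.

Let JG : J * G = 0.
Proof.
rewrite /G mulr_sumr.
have e y : J * (T y *~ chi p y) = J *~ chi p y.
  rewrite mulrzAr /J mulr_suml; congr (_ *~ _).
  by rewrite -[RHS](sum_shift T y); apply: eq_bigr => x _; rewrite -TD addrC.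
by rewrite (eq_bigr _ (fun y _ => e y)) -mulrz_sumr sum_chi // mulr0z.
Qed.

Let GG : G * G = (p%:R - J) *~ chi p (-1).
Proof.
rewrite {1}/G mulr_suml.
have e x : T x *~ chi p x * G = \sum_z T z *~ (chi p (-1) * (chi p x * chi p (x - z))).
  rewrite /G mulr_sumr -(sum_shift _ (- x)); apply: eq_bigr => z _.
  rewrite mulrzAr mulrzAl -mulrzA -TD addrA subrr add0r.
  have -> : - x + z = -1 * (x - z) by ring.
  by rewrite chiM //; congr (_ *~ _); ring.
rewrite (eq_bigr _ (fun x _ => e x)) exchange_big /=.
have e' z : \sum_x T z *~ (chi p (-1) * (chi p x * chi p (x - z)))
   = (T z *~ (p%:R * (z == 0)%:R) - T z) *~ chi p (-1).
  rewrite -mulrz_sumr -mulr_sumr chi_correlation // oppr_eq0 [chi p (-1) * _]mulrC [LHS]mulrzA.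
  by rewrite mulrzBr mulr1z.
rewrite (eq_bigr _ (fun z _ => e' z)) -mulrz_suml sumrB -/J; congr ((_ - _) *~ _).
rewrite (bigD1 0) //= big1 => [|z /negbTE ->]; last by rewrite mulr0 mulr0z.
by rewrite ?eqxx mulr1 T0 addr0 natz -pmulrn.
Qed.

Let G_odd_pow k : G ^+ (k.*2.+1) = G *~ ((chi p (-1) * p%:R) ^+ k).
Proof.
elim: k => [|k IH]; first by rewrite expr1 expr0 mulr1z.
rewrite doubleS !exprS -exprS IH mulrA GG mulrzAr mulrzAl mulrBl JG subr0.
rewrite mulr_natl pmulrn -!mulrzA; congr (_ *~ _); ring.
Qed.

Let commT x y : GRing.comm (T x) (T y).
Proof. by rewrite /GRing.comm -!TD addrC. Qed.

Let frob : G ^+ q = \sum_x (T x *~ chi p x) ^+ q.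
Proof.
rewrite -(pFrobenius_autE chA) /G.
elim: (index_enum _) => [|x r IH]; first by rewrite !big_nil pFrobenius_aut0.
rewrite !big_cons pFrobenius_autD_comm ?IH ?pFrobenius_autE //.
apply: commr_sum => y _; apply: commrMz; apply/commr_sym/commrMz; exact: commT.
Qed.

Let G_frob : odd q -> prime q -> ~~ (p %| q)%N -> G ^+ q = G *~ leg p q.
Proof.
move=> q_odd q_pr pq; rewrite frob.
have q0 : q%:R != 0 :> 'F_p by rewrite Fp_nat_eq0.
have e x : (T x *~ chi p x) ^+ q = T (q%:R * x) *~ chi p (q%:R * x) *~ leg p q.
  rewrite chiM // -mulrzA [leg p q]/(chi p q%:R) mulrAC chi_sq q0 mul1r.
  have Tq : T (q%:R * x) = T x ^+ q.
    elim: q => [|n IH]; first by rewrite mul0r T0 expr0.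
    by rewrite -natr1 mulrDl mul1r TD IH exprSr.
  rewrite Tq /chi; case: ifP => _; first by rewrite !mulr0z expr0n; case: q q_pr.
  by case: ifP => _; rewrite ?mulr1z // !mulrN1z exprNn -signr_odd q_odd expr1 mulN1r.
rewrite (eq_bigr _ (fun x _ => e x)) -mulrz_suml; congr (_ *~ _).
exact: (sum_chi_scale (fun x => T x *~ chi p x) q0).
Qed.

(** Two evaluations of G^q: by iterating the formula for G^3, and by the Frobenius, which replaces x
    by q x and so multiplies G by [leg p q]. *)
Lemma gauss_sum_power : odd q -> prime q -> ~~ (p %| q)%N ->
  G *~ ((chi p (-1) * p%:R) ^+ q.-1./2) = G *~ leg p q.
Proof.
move=> q_odd q_pr pq; rewrite -G_odd_pow -G_frob //; congr (_ ^+ _).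
by have := odd_double_half q.-1; have := prime_gt0 q_pr; case: (q) q_odd => //= n /negbTE ->; rewrite add0n => _ ->.
Qed.
End GaussSum.

Section GaussMatrix.
Variables (p q : nat) (p_pr : prime p) (p_odd : odd p) (q_pr : prime q).
Local Notation np := ((Zp_trunc (pdiv p)).+2).

(* The shift by 1 plays the role of a p-th root of unity in characteristic q. *)
Definition shift_mx (a : 'F_p) : 'M['F_q]_np :=
  \matrix_(i, j) (j == i + a :> 'F_p)%:R.

Lemma shift_mx0 : shift_mx 0 = 1.
Proof. by apply/matrixP => i j; rewrite !mxE addr0 eq_sym. Qed.

Lemma shift_mxD a b : shift_mx (a + b) = shift_mx a * shift_mx b.
Proof.
apply/matrixP => i j; rewrite !mxE (bigD1 (i + a : 'F_p)) //= big1 ?addr0.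
  by rewrite !mxE eqxx mul1r addrA.
by move=> k /negbTE kia; rewrite !mxE kia mul0r.
Qed.

Lemma quadratic_reciprocity : odd q -> ~~ (p %| q)%N ->
  ((chi p (-1))%:~R * p%:R) ^+ q.-1./2 = (leg p q)%:~R :> 'F_q.
Proof.
move=> q_odd pq.
have chA : q \in [pchar 'M['F_q]_np].
  by rewrite (rmorph_pchar (@scalar_mx _ _)) // pchar_Fp.
have := gauss_sum_power p_pr p_odd chA shift_mx0 shift_mxD q_odd q_pr pq.
(* G need not be invertible, so it is not cancelled: its entry at (0, 1) comes from x = 1 alone and
   equals chi 1 = 1, and comparing that entry suffices. *)
have entry (z : int) : ((\sum_x shift_mx x *~ chi p x) *~ z) 0 1 = z%:~R.
  have ez (M : 'M['F_q]_np) (n : int) : (M *~ n) 0 1 = M 0 1 *~ n.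
    by case: n => n; rewrite ?NegzE ?mulrNz -?pmulrn ?mxE ?mulmxnE.
  rewrite ez summxE (bigD1 1) //= big1 ?addr0.
    by rewrite ez mxE add0r eqxx chi1.
  by move=> x /negbTE x1; rewrite ez mxE add0r eq_sym x1 mul0rz.
move/(congr1 (fun M : 'M__ => M 0 1)); rewrite !entry => <-.
by rewrite rmorphXn rmorphM /= rmorph_nat.
Qed.
End GaussMatrix.

Lemma chi_N1 (p : nat) : prime p -> odd p -> chi p (-1) = if (p %% 4 == 1)%N then 1 else -1.
Proof.
move=> p_pr p_odd; rewrite /chi oppr_eq0 oner_eq0 -signr_odd.
have -> : odd p.-1./2 = ~~ (p %% 4 == 1)%N.
  have := odd_double_half p; have := odd_double_half p.-1./2; have := prime_gt1 p_pr.
  have : p.-1./2 = p./2 by case: (p) p_odd => //= n /negbTE on; rewrite uphalf_half on.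
  rewrite p_odd => ->; case: (odd p./2) => /=; lia.
case: (p %% 4 == 1)%N; rewrite ?expr0 ?eqxx ?expr1 //.
by rewrite eq_sym (negbTE (Fp_neq1N1 p_pr p_odd)).
Qed.

Lemma prod_chi_N1 (P : seq nat) : all prime P -> all odd P ->
  odd (\prod_(p <- P) p) /\
  \prod_(p <- P) chi p (-1) = if ((\prod_(p <- P) p) %% 4 == 1)%N then 1 else -1 :> int.
Proof.
elim: P => [|p P IH] /=; first by rewrite !big_nil.
case/andP=> p_pr P_pr /andP[p_odd P_odd]; have [oP IHP] := IH P_pr P_odd.
rewrite !big_cons IHP oddM p_odd oP; split=> //; rewrite chi_N1 // -modnMm.
have mod4 n : odd n -> (n %% 4 = 1 \/ n %% 4 = 3)%N by have := modn2 n; case: odd => //; lia.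
by case: (mod4 p p_odd) => ->; case: (mod4 _ oP) => ->.
Qed.

(** As the product is 3 modulo 4, its negative is the product of the signed primes chi(-1) p, to
    each of which [quadratic_reciprocity] applies. *)
Lemma jac_reciprocity (P : seq nat) (q : nat) : all prime P -> all odd P ->
  ((\prod_(p <- P) p) %% 4 = 3)%N -> prime q -> odd q -> jac P q = -1 ->
  chi q (- (\prod_(p <- P) p)%:R) = -1.
Proof.
move=> P_pr P_odd d3 q_pr q_odd jq.
have [_ eN] := prod_chi_N1 P_pr P_odd; rewrite d3 /= in eN.
have ndv : {in P, forall p, ~~ (p %| q)%N}.
  move=> p pP; have p_pr : prime p := allP P_pr p pP.
  by rewrite -leg_eq0 //; apply: contra_eq_neq jq => e; rewrite /jac (big_rem p) //= e mul0r.
have : (chi q (- (\prod_(p <- P) p)%:R))%:~R = -1 :> 'F_q.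
  rewrite chi_cast //.
  have -> : - (\prod_(p <- P) p)%:R = \prod_(p <- P) ((chi p (-1))%:~R * p%:R) :> 'F_q.
    by rewrite big_split /= -rmorph_prod eN -natr_prod rmorphN1 mulN1r.
  have -> : -1 = (-1 : int)%:~R :> 'F_q by rewrite mulrN1z.
  rewrite -prodrXl -jq /jac rmorph_prod /= big_seq [RHS]big_seq.
  apply: eq_bigr => p pP; apply: quadratic_reciprocity => //.
  - exact: (allP P_pr).
  - exact: (allP P_odd).
  - exact: ndv.
have neq := Fp_neq1N1 q_pr q_odd.
rewrite /chi; case: ifP => [_ /eqP|_]; first by rewrite eq_sym oppr_eq0 oner_eq0.
by case: ifP => // _ /eqP; rewrite (negbTE neq).
Qed.

(** * Chebyshev and the size of omega *)
Lemma prime_ndvd_fact (p n : nat) : prime p -> (n < p)%N -> ~~ (p %| n`!)%N.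
Proof.
move=> p_pr; elim: n => [|n IH] np; first by rewrite fact0 dvdn1; have := prime_gt1 p_pr; lia.
rewrite factS Euclid_dvdM // negb_or IH ?(ltnW np) // andbT.
by apply/negP => /dvdn_leq -/(_ isT); rewrite leqNgt np.
Qed.

Lemma central_bin_le (n : nat) : ('C(2 * n, n) <= 2 ^ (2 * n))%N.
Proof.
rewrite -[2%N in X in (_ <= X)%N]/(1 + 1)%N expnDn.
have nn : (n < (2 * n).+1)%N by lia.
by rewrite (bigD1 (Ordinal nn)) //= !exp1n !muln1 leq_addr.
Qed.

(** Chebyshev's argument: with n = 2^j, the primes in (n, 2n] exceed n and their product divides the
    central binomial coefficient, at most 2^(2n). *)
Lemma count_primes_dyadic (j : nat) :
  (j * size [seq p <- iota (2 ^ j).+1 (2 ^ j) | prime p] <= 2 ^ j.+1)%N.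
Proof.
set n := (2 ^ j)%N; set s := filter _ _.
have sP p : p \in s -> [/\ prime p, (n < p)%N & (p <= 2 * n)%N].
  by rewrite mem_filter mem_iota => /and3P[-> -> ?]; split=> //; lia.
have dvd : (\prod_(p <- s) p %| 'C(2 * n, n))%N.
  apply: prod_primes_dvd; first by rewrite filter_uniq ?iota_uniq.
    by apply/allP => p /sP[].
  move=> p /sP[p_pr np p2n].
  have : (p %| 'C(2 * n, n) * (n`! * (2 * n - n)`!))%N.
    by rewrite bin_fact; [rewrite dvdn_fact // prime_gt0 | lia].
  have -> : (2 * n - n = n)%N by lia.
  by rewrite !Euclid_dvdM // (negbTE (prime_ndvd_fact p_pr np)) !orbF.
have low : (2 ^ (j * size s) <= \prod_(p <- s) p)%N.
  have : {in s, forall p, n <= p}%N by move=> p /sP[_ /ltnW].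
  elim: (s) => [|p r IH] h; first by rewrite muln0 big_nil.
  rewrite big_cons /= mulnS expnD leq_mul ?h ?mem_head // IH // => x xr.
  by apply: h; rewrite inE xr orbT.
have := leq_trans low (leq_trans (dvdn_leq _ dvd) (central_bin_le n)).
by rewrite leq_exp2l // expnS; apply; rewrite bin_gt0; lia.
Qed.

Lemma sum_inv_primes_dyadic (R : realFieldType) (j : nat) : (0 < j)%N ->
  \sum_((2 ^ j).+1 <= p < (2 ^ j.+1).+1 | prime p) p%:R^-1 <= 2 / j%:R :> R.
Proof.
move=> j0; have n0 : (0 < 2 ^ j)%N by rewrite expn_gt0.
apply: (@le_trans _ _ (\sum_((2 ^ j).+1 <= p < (2 ^ j.+1).+1 | prime p) (2 ^ j)%:R^-1)).
  rewrite big_nat_cond [X in _ <= X]big_nat_cond; apply: ler_sum => p /andP[/andP[lo _] _].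
  by rewrite lef_pV2 ?posrE ?ltr0n ?ler_nat //; lia.
rewrite -big_filter big_const_seq count_predT iter_addr addr0.
have -> : index_iota (2 ^ j).+1 (2 ^ j.+1).+1 = iota (2 ^ j).+1 (2 ^ j).
  by rewrite /index_iota; congr iota; rewrite expnS; lia.
have := count_primes_dyadic j; set k := size _; rewrite expnS => le_k.
rewrite -[_ *+ k]mulr_natl ler_pdivrMr ?ltr0n // mulrAC ler_pdivlMr ?ltr0n //.
by rewrite -!natrM ler_nat; lia.
Qed.

Lemma sum_inv_primes_between (R : realFieldType) (a b : nat) : (0 < a)%N -> (a <= b)%N ->
  \sum_((2 ^ a).+1 <= p < (2 ^ b).+1 | prime p) p%:R^-1 <= 2 * (b - a)%:R / a%:R :> R.
Proof.
move=> a0; elim: b => [|b IH] ab; first by lia.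
have [->|lt_ab] := eqVneq a b.+1; first by rewrite big_geq // subnn mulr0 mul0r.
have {}ab : (a <= b)%N by lia.
rewrite (@big_cat_nat _ _ _ (2 ^ b).+1) //=; last 2 first.
- by rewrite ltnS leq_exp2l.
- by rewrite ltnS leq_exp2l.
have -> : (b.+1 - a = (b - a).+1)%N by lia.
rewrite -[(b - a).+1%:R]natr1 mulrDr mulrDl mulr1; apply: lerD; first exact: IH.
apply: (le_trans (sum_inv_primes_dyadic _ _)); first by lia.
by rewrite ler_pM2l // lef_pV2 ?posrE ?ltr0n ?ler_nat //; lia.
Qed.

(** A prime factor p >= 2^k pays for its own 2^k; there are at most 2^k smaller ones, whence C = k
    2^k. *)
Lemma omega_exp_le (k : nat) : exists C, forall d, (0 < d)%N -> (2 ^ (k * omega d) <= 2 ^ C * d)%N.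
Proof.
exists (k * 2 ^ k)%N => d d0; set n := (2 ^ k)%N.
have small : (count (fun p => p < n)%N (primes d) <= n)%N.
  rewrite -size_filter -[X in (_ <= X)%N](size_iota 0 n); apply: uniq_leq_size.
    by rewrite filter_uniq ?primes_uniq.
  by move=> p; rewrite mem_filter mem_iota => /andP[].
have prod_le : (\prod_(p <- primes d) p <= d)%N.
  apply: dvdn_leq => //; apply: prod_primes_dvd; first exact: primes_uniq.
    by apply/allP => p; rewrite mem_primes => /and3P[].
  by move=> p; rewrite mem_primes => /and3P[].
have h : (2 ^ (k * omega d) <= 2 ^ (k * count (fun p => p < n) (primes d)) * \prod_(p <- primes d) p)%N.
  have : {in primes d, forall p, 0 < p}%N by move=> p; rewrite mem_primes => /and3P[/prime_gt0].
  rewrite /omega; elim: (primes d) => [|p s IH] h; first by rewrite big_nil !muln0.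
  have p0 : (0 < p)%N by rewrite h ?mem_head.
  have {}IH := IH (fun x xs => h x (mem_behead (s := p :: s) xs)).
  rewrite big_cons /= mulnS mulnDr !expnD -/n mulnACA leq_mul //.
  by case: ltnP => pn; rewrite ?muln1 ?muln0 ?mul1n // leq_pmulr.
apply: (leq_trans h); apply: leq_mul => //.
by rewrite leq_exp2l // leq_mul2l small orbT.
Qed.

Lemma dyadic_scale (u0 : nat) : exists N, forall d, (N <= d)%N -> exists u,
  [/\ (u0 <= u)%N, (2 ^ (200 * u) <= d)%N, (d < 2 ^ (200 * u.+1))%N & (omega d <= u)%N].
Proof.
(* As log2 d is about 200 u, the exponent 400 bounds omega d by about u/2, leaving room for [C]. *)
have [C hC] := omega_exp_le 400.
exists (2 ^ (200 * (C + u0 + 300)))%N => d dN.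
have d0 : (0 < d)%N by apply: leq_trans dN; rewrite expn_gt0.
have /andP[lo hi] := trunc_log_bounds (isT : 1 < 2)%N d0.
set L := trunc_log 2 d in lo hi; exists (L %/ 200)%N.
have dL : (C + u0 + 300 <= L %/ 200)%N.
  rewrite leq_divRL // mulnC -ltnS -(ltn_exp2l _ _ (isT : 1 < 2)%N).
  exact: leq_ltn_trans dN hi.
have LE := divn_eq L 200; have LM : (L %% 200 < 200)%N by rewrite ltn_mod.
move: (L %/ 200)%N (L %% 200)%N LE LM dL => u v LE LM dL.
have hi' : (d < 2 ^ (200 * u.+1))%N by apply: (leq_trans hi); rewrite leq_exp2l //; lia.
split=> //; first by lia.
  by apply: leq_trans lo; rewrite leq_exp2l //; lia.
have : (2 ^ (400 * omega d) <= 2 ^ (C + 200 * u.+1))%N.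
  by apply: (leq_trans (hC d d0)); rewrite expnD leq_mul // ltnW.
by rewrite leq_exp2l //; lia.
Qed.

(** * Primes that are not residues *)
Lemma jacM (P : seq nat) (a b : nat) : all prime P -> all odd P -> jac P (a * b) = jac P a * jac P b.
Proof.
move=> pP oP; rewrite /jac -big_split /= [LHS]big_seq [RHS]big_seq.
by apply: eq_bigr => p pp; rewrite legM ?(allP pP p pp) ?(allP oP p pp).
Qed.

Lemma jac1 (P : seq nat) : all prime P -> jac P 1 = 1.
Proof. by move=> pP; rewrite /jac big_seq big1 // => p pp; rewrite leg1 ?(allP pP p pp). Qed.

Lemma jac_values (P : seq nat) (n : nat) : all prime P ->
  [\/ jac P n = 0, jac P n = 1 | jac P n = -1].
Proof.
elim: P => [|p P IH] /=; first by rewrite /jac big_nil; constructor 2.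
case/andP=> p_pr /IH; rewrite /jac big_cons => IHP.
case: (legP p_pr n) => [] [_ ->]; case: IHP => ->; rewrite ?mul0r ?mulr0 ?mulrNN ?mulr1 ?mul1r;
  by [constructor 1|constructor 2|constructor 3].
Qed.

Lemma jac_neq1_prime_factor (P : seq nat) (n : nat) : all prime P -> all odd P -> (0 < n)%N ->
  odd n -> jac P n != 1 -> exists q, [/\ prime q, odd q, (q %| n)%N & jac P q != 1].
Proof.
move=> pP oP; have [k] := ubnP n; elim: k n => // k IH n nk n0 on jn.
have [n1|n1] := leqP n 1.
  by have e : n = 1%N; [lia | move: jn; rewrite e jac1 // eqxx].
have pn := pdiv_prime n1; have dn := pdiv_dvd n; have en := divnK dn.
have [j1|j1] := eqVneq (jac P (pdiv n)) 1; last first.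
  by exists (pdiv n); split=> //; apply: (dvdn_odd dn on).
have n'0 : (0 < n %/ pdiv n)%N by rewrite divn_gt0 ?pdiv_gt0 ?pdiv_leq.
have [||//||q [q_pr q_odd qn jq]] := IH (n %/ pdiv n)%N.
- by apply: leq_trans (ltn_Pdiv (prime_gt1 pn) n0) _; rewrite -ltnS.
- exact: n'0.
- by apply: (dvdn_odd (dvdn_div dn) on).
- by move: jn; rewrite -{1}en jacM // j1 mulr1.
by exists q; split=> //; apply: dvdn_trans qn (dvdn_div dn).
Qed.

Definition bad_prime (P : seq nat) (q : nat) : bool := [&& prime q, odd q & jac P q != 1].

(** The nonnegative function 1 - jac is at most twice the indicator of jac != 1, and its double sum
    is H^2 - S with S small by the variance of jac. *)
Lemma jac_mass (P : seq nat) (H : nat) : uniq P -> all prime P -> all odd P ->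
  (0 < H)%N -> (H <= \prod_(p <- P) p)%N -> (128 * 2 ^ size P * \prod_(p <- P) p <= H * H)%N ->
  7 * H%:R <= 16 * \sum_(0 <= s < 2 * H) (jac P (2 * s + 1) != 1)%:R :> int.
Proof.
move=> uP pP oP H0 HD big.
have P2 : {in P, forall p, ~~ (p %| 2)%N}.
  move=> p pp; apply/negP => /dvdn_leq -/(_ isT).
  by have := prime_gt1 (allP pP p pp); have := allP oP p pp; case: p {pp} => [|[|[|]]].
have dev := jac_double_sum 1 uP pP oP P2 HD HD.
set S := \sum_(0 <= a < H) _ in dev.
set h := H%:R in dev *; have h0 : 0 < h by rewrite ltr0n.
(* The constant 128 is 2 times 8^2: S^2 <= 2 h^2 K M <= h^4 / 64. *)
have S8 : 8 * S <= h * h.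
  move: big; rewrite -(ler_nat int) !natrM natrX -/h.
  set K := 2 ^+ _ in dev *; set M : int := (\prod_(p <- P) p)%N%:R in dev * => big.
  have hh0 : 0 <= h * h by apply: mulr_ge0; exact: ltW.
  have big' : 128 * (K * M) <= h * h by apply: le_trans big; rewrite le_eqVlt; apply/orP; left; apply/eqP; rewrite /M; ring.
  have dev' : S ^+ 2 <= (h * h) * (2 * (K * M)) by apply: (le_trans dev); rewrite le_eqVlt; apply/orP; left; apply/eqP; rewrite /M; ring.
  move: (h * h) (K * M) hh0 big' dev' => t k t0 tk St.
  rewrite leNgt; apply/negP => lt.
  have h1 := ler_wpM2l t0 tk.
  have h2 : 0 < (8 * S - t) * (8 * S + t) by apply: mulr_gt0; lia.
  have e : (8 * S - t) * (8 * S + t) = 64 * S ^+ 2 - t * t by ring.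
  lia.
pose f n : int := 1 - jac P (2 * n + 1).
have f0 n : 0 <= f n by rewrite /f; case: (jac_values (2 * n + 1) pP) => ->.
have f2 n : f n <= 2 * (jac P (2 * n + 1) != 1)%:R.
  by rewrite /f; case: (jac_values (2 * n + 1) pP) => ->.
have up := double_sum_le H f0.
have lowS : \sum_(0 <= a < H) \sum_(0 <= b < H) f (a + b)%N = h * h - S.
  rewrite /f /S (eq_bigr (fun a => h - \sum_(0 <= b < H) jac P (2 * (a + b) + 1))); last first.
    by move=> a _; rewrite sumrB sumr_const_nat subn0.
  by rewrite sumrB sumr_const_nat subn0 -mulr_natl.
have fs : \sum_(0 <= s < 2 * H) f s <= 2 * \sum_(0 <= s < 2 * H) (jac P (2 * s + 1) != 1)%:R.
  by rewrite mulr_sumr; apply: ler_sum => s _.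
rewrite lowS -/h in up; move: up fs; set A := \sum_(0 <= s < _) f s; set B := \sum_(0 <= s < _) _.
move=> up fs; rewrite -(ler_pM2l h0).
have h3 := ler_wpM2l (ltW h0) fs.
lia.
Qed.

Lemma sum_dvd_odd_le (R : realFieldType) (N q : nat) : (0 < q)%N ->
  \sum_(0 <= s < N) (q %| 2 * s + 1)%:R <= (2 * N)%:R / q%:R :> R.
Proof.
move=> q0; have le1 : (\sum_(0 <= s < N) (q %| 2 * s + 1) <= \sum_(1 <= n < (2 * N).+1) (q %| n))%N.
  elim: N => [|N IH]; first by rewrite !big_geq.
  rewrite mulnS add2n big_nat_recr // [X in (_ <= X)%N]big_nat_recr // [X in (_ <= X + _)%N]big_nat_recr //= addn1.
  by apply: leq_trans (leq_addr _ _); rewrite leq_add2r.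
rewrite -divn_count_dvd in le1; rewrite -natr_sum ler_pdivlMr ?ltr0n // -natrM ler_nat.
apply: leq_trans (leq_trunc_div (2 * N) q); by rewrite leq_mul2r le1 orbT.
Qed.

(** At least 7H/16 odd integers below 4H have symbol different from 1. Each has a bad prime factor,
    and a given q divides at most 4H/q of them. *)
Lemma bad_prime_mass (R : realFieldType) (P : seq nat) (H : nat) : uniq P -> all prime P -> all odd P ->
  (0 < H)%N -> (H <= \prod_(p <- P) p)%N -> (128 * 2 ^ size P * \prod_(p <- P) p <= H * H)%N ->
  7 / 64 <= \sum_(0 <= q < (4 * H).+1 | bad_prime P q) q%:R^-1 :> R.
Proof.
move=> uP pP oP H0 HD big; have mass := jac_mass uP pP oP H0 HD big.
have le1 : \sum_(0 <= s < 2 * H) (jac P (2 * s + 1) != 1)%:R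
    <= \sum_(0 <= q < (4 * H).+1 | bad_prime P q) \sum_(0 <= s < 2 * H) (q %| 2 * s + 1)%:R :> R.
  rewrite exchange_big_nat /=; apply: ler_sum_nat => s /andP[_ sH].
  case: (boolP (jac P (2 * s + 1) != 1)) => [js|_]; last by apply: sumr_ge0.
  have on : odd (2 * s + 1) by rewrite addn1 /= oddM.
  have [|q [q_pr q_odd qn jq]] := jac_neq1_prime_factor pP oP _ on js; first by rewrite addn1.
  have qI : q \in index_iota 0 (4 * H).+1.
    by rewrite mem_index_iota /=; have := dvdn_leq _ qn; rewrite addn1 => /(_ isT); lia.
  rewrite big_mkcond (bigD1_seq q) ?iota_uniq //= {1}/bad_prime q_pr q_odd jq /=.
  by rewrite qn lerDl; apply: sumr_ge0 => i _; case: ifP.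
have le2 : \sum_(0 <= q < (4 * H).+1 | bad_prime P q) \sum_(0 <= s < 2 * H) (q %| 2 * s + 1)%:R
    <= (4 * H)%:R * \sum_(0 <= q < (4 * H).+1 | bad_prime P q) q%:R^-1 :> R.
  rewrite mulr_sumr; apply: ler_sum => q /and3P[q_pr _ _].
  have := sum_dvd_odd_le R (2 * H) (prime_gt0 q_pr).
  by have -> : (2 * (2 * H) = 4 * H)%N by lia.
move: mass; rewrite -(ler_int R) !rmorphM /= !rmorph_nat rmorph_sum /=.
under [X in _ <= _ * X -> _]eq_bigr do rewrite rmorph_nat.
move=> mass; have H0R : 0 < H%:R :> R by rewrite ltr0n.
move: (le_trans le1 le2) mass; rewrite natrM.
set A := \sum_(0 <= s < _) _; set B := \sum_(0 <= q < _ | _) _ => h1 h2.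
have h3 : 7 * H%:R <= 64 * H%:R * B by lra.
rewrite ler_pdivrMr // -(ler_pM2l H0R); lra.
Qed.

(** * Counting excluded integers *)
Lemma sum_divmod (f : nat -> int) (k g : nat) :
  \sum_(0 <= s < k * g) f s = \sum_(0 <= t < k) \sum_(0 <= c < g) f (t * g + c)%N.
Proof.
elim: k => [|k IH]; first by rewrite !big_geq.
rewrite big_nat_recr //= -IH mulSn addnC (@big_cat_nat _ _ _ (k * g)) ?leq_addr //=.
congr (_ + _); have := big_addn 0 (k * g + g) (k * g) xpredT f; rewrite add0n => ->.
by rewrite addKn; apply: eq_bigr => c _; rewrite addnC.
Qed.

Lemma sum_residue_class_le (f : nat -> int) (g c N M : nat) : (forall n, 0 <= f n) ->
  (c < g)%N -> (N * g <= M)%N ->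
  \sum_(0 <= t < N) f (t * g + c)%N <= \sum_(0 <= r < M) f r.
Proof.
move=> f0 cg NM; rewrite [X in _ <= X](@big_cat_nat _ _ _ (N * g)) //= sum_divmod.
apply: ler_wpDr; first by apply: sumr_ge0.
apply: ler_sum => t _; have cI : c \in index_iota 0 g by rewrite mem_index_iota.
by rewrite [X in _ <= X](bigD1_seq c) ?iota_uniq //= lerDl sumr_ge0.
Qed.

Lemma wt_le_pow (P : seq nat) (n : nat) : all prime P -> wt P n <= 2 ^+ size P.
Proof.
rewrite /wt; elim: P => [|p P IH] /=; first by rewrite big_nil.
case/andP=> p_pr pP; rewrite big_cons exprS ler_pM ?rho_ge0 ?rho_le2 ?IH //.
exact: wt_ge0 pP n.
Qed.

Lemma odd_primes_off1 (d : nat) : odd d -> odd_primes_off d 1 = primes d.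
Proof.
move=> od; rewrite /odd_primes_off -[RHS]filter_predT; apply: eq_in_filter => p.
rewrite mem_primes => /and3P[p_pr _ pd]; rewrite (dvdn_odd pd od) dvdn1 /=.
by have := prime_gt1 p_pr; lia.
Qed.

Lemma divn_exp2_ge (d m a b : nat) : (0 < m)%N -> (2 ^ a <= d)%N -> (m <= 2 ^ b)%N -> (b <= a)%N ->
  (2 ^ (a - b) <= d %/ m)%N.
Proof.
move=> m0 ad mb ba; rewrite leq_divRL //; apply: leq_trans ad.
by rewrite -[in X in (_ <= X)%N](subnK ba) expnD leq_mul2l mb orbT.
Qed.

(* When q divides d, the condition is the q-adic one: for r = q s and d = q e, solubility over Q_q
   fails exactly when (s e / q) = -1. *)
Definition obstructed (d q r : nat) : bool :=
  [&& (q %| r)%N, ~~ (q %| r %/ q)%N & ~~ (q %| d)%N || (leg q (r %/ q * (d %/ q)) == -1)].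

Lemma obstructed_not_rat_rep (d q r : nat) : (0 < d)%N -> squarefree d -> (d %% 8 = 7)%N ->
  bad_prime (odd_primes_off d 1) q -> obstructed d q r -> ~ rat_rep d r%:Z.
Proof.
move=> d0 sf d7 /and3P[q_pr q_odd jq] /and3P[qr qs].
have od : odd d by have := modn2 d; case: (odd d) => //=; lia.
have rE : r = (q * (r %/ q))%N by rewrite mulnC divnK.
case: (boolP (q %| d)%N) => [qd|qd _] /=.
  move/eqP=> lq; rewrite rE -[d](divnK qd) [(d %/ q * q)%N]mulnC.
  exact: ramified_obstruction.
rewrite rE; apply: nonresidue_obstruction => //.
have pP := prime_odd_primes_off d 1; have oP := odd_odd_primes_off d 1.
have jN : jac (odd_primes_off d 1) q = -1.
  case: (jac_values q pP) => // [/eqP|j1]; last by rewrite j1 eqxx in jq.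
  rewrite /jac prodf_seq_eq0 => /hasP[p pp /=].
  have p_pr : prime p := allP pP p pp.
  rewrite leg_eq0 // dvdn_prime2 // => /eqP pq; move: pp qd.
  by rewrite mem_odd_primes_off mem_primes pq => /and3P[_ _ /and3P[_ _ ->]].
have := jac_reciprocity pP oP _ q_pr q_odd jN.
by rewrite odd_primes_off1 // squarefree_prod_primes // => -> //; lia.
Qed.

(* With d about 2^(200 u), the cut-offs d^(1/5), d^(1/2-eps), d^(1/2+eps) are 2^(40 u), 2^(99 u), 2^(101 u),
   while 2^(omega d) is at most 2^u. *)
Section Scale.
Variables (d u : nat).
Hypotheses (sf : squarefree d) (u_big : (300 <= u)%N).
Hypotheses (d_ge : (2 ^ (200 * u) <= d)%N) (d_lt : (d < 2 ^ (200 * u.+1))%N) (om : (omega d <= u)%N).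

Local Notation W := (wt (odd_primes_off d 1)).

Lemma scale_gt0 : (0 < d)%N.
Proof. by apply: leq_trans d_ge; rewrite expn_gt0. Qed.

Lemma W_ge0 n : 0 <= W n.
Proof. exact/wt_ge0/prime_odd_primes_off. Qed.

(** The left side is at most 2^7 2^u 2^(200(u+1)) = 2^(201 u + 207): any length slightly above the
    square root of d is admissible. *)
Lemma volume_bound (m X e : nat) : (2 ^ e <= X)%N -> (201 * u + 208 <= 2 * e)%N ->
  (128 * 2 ^ size (odd_primes_off d m) * \prod_(p <- odd_primes_off d m) p <= X * X)%N.
Proof.
move=> eX ue; apply: (@leq_trans (2 ^ 7 * 2 ^ u * 2 ^ (200 * u.+1))); last first.
  by apply: leq_trans (leq_mul eX eX); rewrite -!expnD leq_exp2l //; lia.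
rewrite leq_mul ?leq_mul //; last first.
  by apply: leq_trans (ltnW d_lt); apply: prod_odd_primes_off_le; exact: scale_gt0.
by rewrite leq_exp2l // (leq_trans (size_odd_primes_off d m)).
Qed.

(** The primes shared with [m] also divide [c], hence the whole progression, so their factor rho is
    1. The integer [n] bounds what they, and 2 if [d] is even, remove from [d]; the remaining
    modulus is still at least [H]. *)
Lemma progression_lower (m n c H e : nat) :
  {in primes d, forall p, odd p -> (p %| m)%N -> (p %| n)%N && (p %| c)%N} ->
  (0 < n)%N -> odd d || (2 %| n)%N -> (n * H <= d)%N -> (2 ^ e <= H)%N -> (201 * u + 208 <= 2 * e)%N ->
  H%:R <= 2 * \sum_(0 <= s < 2 * H) W (m * s + c).
Proof.
move=> mnc n0 dn nH eH ue.
have HD : (H <= \prod_(p <- odd_primes_off d m) p)%N.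
  rewrite -(leq_pmul2l n0); apply: (leq_trans nH); apply: squarefree_le_odd_primes_off => //.
    exact: scale_gt0.
  by move=> p pd po pm; case/andP: (mnc p pd po pm).
have vol : (4 * 2 ^ size (odd_primes_off d m) * \prod_(p <- odd_primes_off d m) p <= H * H)%N.
  by apply: leq_trans (volume_bound m eH ue); rewrite !leq_mul.
apply: (le_trans (wt_sum_lower c (uniq_odd_primes_off d m) (prime_odd_primes_off d m)
  (odd_odd_primes_off d m) (@ndvd_odd_primes_off d m) HD vol)).
rewrite le_eqVlt; apply/orP; left; apply/eqP; congr (_ * _); apply: eq_bigr => s _.
symmetry; apply: wt_odd_primes_off => p pd po pm.
by case/andP: (mnc p pd po pm) => _ pc; rewrite dvdn_add // dvdn_mulr.
Qed.

Lemma two_adic_lower : (d %% 8 != 7)%N -> d%:R <= 256 * (Dsum d)%:R :> int.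
Proof.
(* For s < 2H and c < 8 one has 8 s + c < 16 H <= d/4. *)
move=> d7; set H := (d %/ 64)%N; set c := two_adic_class d.
have c8 : (0 < c < 8)%N by rewrite /c /two_adic_class; case: ifP => _ //; case: ifP.
have HE : (2 ^ (200 * u - 6) <= H)%N by apply: divn_exp2_ge => //; lia.
have Hd : (64 * H <= d)%N by rewrite mulnC leq_trunc_div.
have dH : (d < 64 * H.+1)%N by rewrite mulnC ltn_ceil.
have H0 : (0 < H)%N by apply: leq_trans HE; rewrite expn_gt0.
have low : H%:R <= 2 * \sum_(0 <= s < 2 * H) W (8 * s + c).
  apply: (@progression_lower 8 2 c H (200 * u - 6)) => //; [|exact: orbT|lia|lia].
  move=> p; rewrite mem_primes => /and3P[p_pr _ _] po.
  by rewrite -[8%N]/(2 ^ 3)%N Euclid_dvdX // dvdn_prime2 // => /andP[/eqP p2]; rewrite p2 in po.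
pose S r := (4 * r < d)%N && (r %% 8 == c)%N.
have up : \sum_(0 <= s < 2 * H) W (8 * s + c) <= \sum_(0 <= r < d | S r) W r.
  rewrite [X in _ <= X]big_mkcond /=.
  apply: le_trans (sum_residue_class_le (c := c) (g := 8) (N := 2 * H) (M := d) (f := fun r => if S r then W r else 0) _ _ _).
  - apply: ler_sum_nat => s /andP[_ sH].
    rewrite mulnC; have -> : S (s * 8 + c)%N; last by [].
    by rewrite /S modnMDl modn_small; [rewrite eqxx andbT; lia | lia].
  - by move=> r; case: ifP => // _; exact: W_ge0.
  - by lia.
  - by lia.
have Dl : \sum_(0 <= r < d | S r) W r <= (Dsum d)%:R.
  apply: sum_wt_le_Dsum => //; first exact: scale_gt0.
  move=> r /andP[r4 /eqP rc]; split=> //; first by case: (r) rc c8 => //; rewrite mod0n => <-.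
  apply: two_adic_obstruction => //.
  by apply: contra (sf (isT : prime 2)) => /eqP d4; rewrite /dvdn d4.
lia.
Qed.

(** The range of [m] covers products of two primes up to 2^(40 u), as the second moment requires;
    the quotients r/m still fill an interval of length about 2^(120 u), beyond the square root of
    d. *)
Lemma multiples_upper (m : nat) : odd d -> (0 < m)%N -> (m <= 2 ^ (80 * u))%N ->
  m%:R * \sum_(0 <= r < d | (4 * r < d)%N && (m %| r)%N) W r <= 2 * d%:R.
Proof.
move=> od m0 mu; set X := (d %/ (4 * m)).+1.
have q_ge : (2 ^ (200 * u - (80 * u + 2)) <= d %/ (4 * m))%N.
  apply: divn_exp2_ge => //; [lia | | lia].
  by rewrite expnD mulnC leq_mul.
have big : (4 <= d %/ (4 * m))%N.
  by apply: leq_trans q_ge; rewrite -[4%N]/(2 ^ 2)%N leq_exp2l //; lia.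
have lo := leq_trunc_div d (4 * m); have hi := ltn_ceil d (_ : 0 < 4 * m)%N.
have hiX : (d < X * (4 * m))%N by apply: hi; lia.
have XD : (2 * X <= \prod_(p <- odd_primes_off d m) p)%N.
  rewrite -(leq_pmul2l m0); apply: (@leq_trans d); first by rewrite /X; nia.
  apply: squarefree_le_odd_primes_off => //; first exact: scale_gt0.
  by rewrite od.
have vol : (2 ^ size (odd_primes_off d m) * \prod_(p <- odd_primes_off d m) p <= 2 * X * X)%N.
  have := @volume_bound m X (200 * u - (80 * u + 2)) _ _.
  move=> /(_ (leqW q_ge) _) h; apply: (@leq_trans (X * X)); last by rewrite -mulnA leq_pmull.
  by apply: leq_trans (h _); [rewrite leq_mul // leq_pmull | lia].
have up := wt_sum_upper (uniq_odd_primes_off d m) (prime_odd_primes_off d m)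
  (odd_odd_primes_off d m) (@ndvd_odd_primes_off d m) XD vol.
have le1 : \sum_(0 <= r < d | (4 * r < d)%N && (m %| r)%N) W r
    <= \sum_(0 <= s < X) wt (odd_primes_off d m) (m * s).
  have -> : \sum_(0 <= s < X) wt (odd_primes_off d m) (m * s) =
      \sum_(0 <= r < X * m | (m %| r)%N) W r.
    rewrite [RHS]big_mkcond /= sum_divmod; apply: eq_bigr => s _.
    rewrite -[m in index_iota 0 m](prednK m0) big_nat_recl // big1_seq ?addr0.
      rewrite addn0 dvdn_mull // mulnC; symmetry; apply: wt_odd_primes_off => p _ _ pm.
      by rewrite dvdn_mull.
    move=> c; rewrite mem_index_iota => /andP[_ /andP[_ cm]]; rewrite dvdn_addr ?dvdn_mull //.
    by rewrite gtnNdvd //; lia.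
  rewrite big_mkcond [X in _ <= X]big_mkcond /=.
  have pos r : 0 <= (if (m %| r)%N then W r else 0) by case: ifP => // _; exact: W_ge0.
  case: (leqP (X * m) d) => [Xd|dX].
    rewrite (@big_cat_nat _ _ _ (X * m)) //= [Y in _ + Y]big1_seq ?addr0.
      by apply: ler_sum => r _; case: (4 * r < d)%N => //=.
    by move=> r; rewrite mem_index_iota => /andP[_ /andP[Xr _]]; have -> : (4 * r < d)%N = false by nia.
  rewrite [Y in _ <= Y](@big_cat_nat _ _ _ d) //=; last by exact: ltnW.
  apply: ler_wpDr; first by apply: sumr_ge0.
  by apply: ler_sum => r _; case: (4 * r < d)%N => //=.
have Xm : (m * (4 * X) <= 2 * d)%N by rewrite /X; nia.
have h := ler_wpM2l (ler0n _ m) (le_trans le1 up).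
apply: (le_trans h); rewrite -(ler_nat int) !natrM in Xm.
exact: Xm.
Qed.
End Scale.

(** * Integers excluded by a single prime *)

Definition obstructed_class (d q c : nat) : bool :=
  ~~ (q %| c)%N && (~~ (q %| d)%N || (leg q (c * (d %/ q)) == -1)).

Lemma obstructed_mul (d q t c : nat) : prime q -> odd q ->
  obstructed d q ((t * q + c) * q) = obstructed_class d q c.
Proof.
move=> q_pr q_odd; rewrite /obstructed /obstructed_class dvdn_mull // mulnK ?prime_gt0 //=.
rewrite dvdn_addr ?dvdn_mull //; congr (_ && (_ || (_ == _))).
by apply: leg_eqmod => //; rewrite mulnDl mulnAC modnMDl.
Qed.

Lemma squarefree_ndvd_div (d q : nat) : squarefree d -> prime q -> (q %| d)%N -> ~~ (q %| d %/ q)%N.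
Proof. by move=> sf q_pr qd; apply: contra (sf q q_pr) => h; rewrite -(divnK qd) dvdn_mul. Qed.

Lemma count_obstructed_class (d q : nat) : squarefree d -> prime q -> odd q ->
  q%:R <= 3 * \sum_(0 <= c < q) (obstructed_class d q c)%:R :> int.
Proof.
move=> sf q_pr q_odd; have q3 : (2 < q)%N by have := prime_gt1 q_pr; case: q q_odd {q_pr} => [|[|[|]]].
have zero : \sum_(0 <= c < q) (c == 0)%N%:R = 1 :> int.
  by rewrite big_ltn; [rewrite big1_seq ?addr0 // => c; rewrite mem_index_iota => /andP[_ /andP[]]; case: c | lia].
have ndvd c : (c < q)%N -> (q %| c)%N = (c == 0)%N.
  by case: c => [|c] cq; [rewrite dvdn0 | rewrite gtnNdvd].
(* Unramified, all q - 1 nonzero classes are obstructed. Ramified, twice the indicator plus [c = 0]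
   dominates 1 minus the symbol, which sums to q. The resulting 2 N + 1 >= q >= 3 gives N >= 1,
   hence 3 N >= q. *)
suff : q%:R <= 2 * \sum_(0 <= c < q) (obstructed_class d q c)%:R + \sum_(0 <= c < q) (c == 0)%N%:R :> int.
  by rewrite zero; set S := \sum_(0 <= c < q) _; lia.
rewrite mulr_sumr -big_split /=.
case: (boolP (q %| d)%N) => qd; last first.
  have -> : q%:R = \sum_(0 <= c < q) 1 :> int by rewrite sumr_const_nat subn0.
  apply: ler_sum_nat => c /andP[_ cq]; rewrite /obstructed_class qd ndvd //.
  by case: (c == 0)%N.
have -> : q%:R = \sum_(0 <= c < q) (1 - leg q (d %/ q * c + 0)) :> int.
  by rewrite sumrB sum_leg_affine ?squarefree_ndvd_div // sumr_const_nat subn0 subr0.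
apply: ler_sum_nat => c /andP[_ cq]; rewrite /obstructed_class qd /= addn0 mulnC ndvd //.
case: eqVneq => [->|c0] /=; first by rewrite mul0n; case: (legP q_pr 0) => [] [] //= _ ->.
case: (legP q_pr (c * (d %/ q))) => [] [qc ->] //.
by move: qc; rewrite Euclid_dvdM // ndvd // (negbTE c0) (negbTE (squarefree_ndvd_div sf q_pr qd)).
Qed.

Lemma slack_count (k h s H : nat) :
  (8 * k <= H)%N -> (8 * k * h <= H)%N -> (8 * k * s <= 8 * k * (1 + h))%N -> (4 * (k * s) <= H)%N.
Proof. by rewrite mulnDr muln1 -!mulnA; lia. Qed.

Section PrimeLower.
Variables (d u : nat).
Hypotheses (sf : squarefree d) (u_big : (300 <= u)%N) (d_odd : odd d).
Hypotheses (d_ge : (2 ^ (200 * u) <= d)%N) (d_lt : (d < 2 ^ (200 * u.+1))%N) (om : (omega d <= u)%N).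
Variables (q : nat) (q_pr : prime q) (q_odd : odd q).

Local Notation W := (wt (odd_primes_off d 1)).

Let F r := if (4 * r < d)%N && obstructed d q r then W r else 0.

Let F_ge0 r : 0 <= F r. Proof. by rewrite /F; case: ifP => // _; exact: W_ge0. Qed.

Let q0 : (0 < q)%N. Proof. exact: prime_gt0. Qed.

(** Whether a multiple of q is obstructed depends on its class modulo q^2. At least q/3 classes
    qualify, and for such small q each is a progression long enough for equidistribution. *)
Lemma small_prime_lower : (q <= 2 ^ (40 * u))%N ->
  d%:R <= 96 * q%:R * \sum_(0 <= r < d | (4 * r < d)%N && obstructed d q r) W r.
Proof.
(* So q^2 t + c q < 2 H q^2 <= d/4 for t < 2H and c < q. *)
move=> qu; set H := (d %/ (8 * (q * q)))%N.
have HE : (2 ^ (200 * u - (80 * u + 3)) <= H)%N.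
  apply: divn_exp2_ge => //; [by rewrite !muln_gt0 q0 | | lia].
  have -> : (80 * u + 3 = 3 + (40 * u + 40 * u))%N by lia.
  by rewrite expnD (expnD 2 (40 * u) (40 * u)); apply: (@leq_mul 8 _ (2 ^ 3)) => //; apply: leq_mul.
have H0 : (0 < H)%N by apply: leq_trans HE; rewrite expn_gt0.
have lo := leq_trunc_div d (8 * (q * q)); rewrite -/H in lo.
have hi : (d < H.+1 * (8 * (q * q)))%N by apply: ltn_ceil; rewrite !muln_gt0 q0.
have each c : H%:R <= 2 * \sum_(0 <= t < 2 * H) W (q * q * t + c * q).
  apply: (@progression_lower d u sf u_big d_ge d_lt om (q * q) q (c * q) H (200 * u - (80 * u + 3))) => //.
  - move=> p; rewrite mem_primes => /and3P[p_pr _ _] _; rewrite Euclid_dvdM // orbb => pq.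
    by rewrite pq dvdn_mull.
  - by rewrite d_odd.
  - by nia.
  - by lia.
have e : \sum_(0 <= r < d | (4 * r < d)%N && obstructed d q r) W r = \sum_(0 <= r < d) F r.
  by rewrite big_mkcond.
have le1 : \sum_(0 <= s < 2 * H * q) F (s * q + 0)%N <= \sum_(0 <= r < d) F r.
  by apply: sum_residue_class_le => //; nia.
have eq2 : \sum_(0 <= s < 2 * H * q) F (s * q + 0)%N =
    \sum_(0 <= c < q) (obstructed_class d q c)%:R * \sum_(0 <= t < 2 * H) W (q * q * t + c * q).
  rewrite sum_divmod exchange_big_nat /=; apply: eq_big_nat => c /andP[_ cq].
  rewrite mulr_sumr; apply: eq_big_nat => t /andP[_ tH].
  rewrite addn0 /F obstructed_mul //.
  have -> : (4 * ((t * q + c) * q) < d)%N by nia.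
  have -> : ((t * q + c) * q = q * q * t + c * q)%N by nia.
  by case: (obstructed_class d q c); rewrite ?mul1r ?mul0r.
have le3 : H%:R * \sum_(0 <= c < q) (obstructed_class d q c)%:R
   <= 2 * \sum_(0 <= c < q) (obstructed_class d q c)%:R * \sum_(0 <= t < 2 * H) W (q * q * t + c * q) :> int.
  rewrite !mulr_sumr; apply: ler_sum => c _.
  by case: (obstructed_class d q c); [rewrite mulr1 mul1r; exact: each | rewrite mulr0 mul0r mulr0].
have cnt := count_obstructed_class sf q_pr q_odd.
rewrite e; rewrite -eq2 in le3; move: le1 le3 cnt.
set A := \sum_(0 <= s < _) F _; set B := \sum_(0 <= r < d) F r; set C := \sum_(0 <= c < q) _.
move=> le1 le3 cnt.
have l4 : q%:R * H%:R <= 6 * B.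
  have := ler_wpM2r (ler0n int H) cnt; lia.
have l5 : d%:R <= 16 * q%:R * (q%:R * H%:R) :> int.
  by rewrite -!natrM ler_nat; nia.
have := ler_wpM2l (_ : 0 <= 16 * q%:R) l4; rewrite mulr_ge0 // => /(_ isT); lia.
Qed.

(** Classes modulo q^2 may now be too sparse, so all multiples of q are counted and those of q^2
    removed. The latter are at most 1 + 2H/q in number with weight at most 2^u each, negligible as q
    > 2^(40 u). *)
Lemma large_prime_lower : ~~ (q %| d)%N -> (2 ^ (40 * u) < q)%N -> (q <= 2 ^ (99 * u))%N ->
  d%:R <= 64 * q%:R * \sum_(0 <= r < d | (4 * r < d)%N && obstructed d q r) W r.
Proof.
move=> qd qlo qu; set H := (d %/ (8 * q))%N.
have HE : (2 ^ (200 * u - (99 * u + 3)) <= H)%N.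
  apply: divn_exp2_ge => //; [by rewrite muln_gt0 q0 | | lia].
  by rewrite expnD mulnC -[8%N]/(2 ^ 3)%N leq_mul.
have H0 : (0 < H)%N by apply: leq_trans HE; rewrite expn_gt0.
have lo := leq_trunc_div d (8 * q); rewrite -/H in lo.
have hi : (d < H.+1 * (8 * q))%N by apply: ltn_ceil; rewrite muln_gt0 q0.
have low : H%:R <= 2 * \sum_(0 <= s < 2 * H) W (q * s + 0).
  apply: (@progression_lower d u sf u_big d_ge d_lt om q q 0 H (200 * u - (99 * u + 3))) => //.
  - by move=> p _ _ ->; rewrite dvdn0.
  - by rewrite d_odd.
  - by nia.
  - by lia.
have le1 : \sum_(0 <= s < 2 * H) F (s * q + 0)%N <= \sum_(0 <= r < d) F r.
  by apply: sum_residue_class_le => //; nia.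
pose K : int := 2 ^+ u.
have WK n : W n <= K.
  apply: (le_trans (wt_le_pow n (prime_odd_primes_off d 1))); rewrite /K ler_eXn2l //.
  exact: leq_trans (size_odd_primes_off d 1) om.
have le2 : \sum_(0 <= s < 2 * H) W (q * s + 0)
   <= \sum_(0 <= s < 2 * H) F (s * q + 0)%N + K * \sum_(0 <= s < 2 * H) (q %| s)%:R.
  rewrite mulr_sumr -big_split /=; apply: ler_sum_nat => s /andP[_ sH].
  rewrite !addn0 /F /obstructed qd dvdn_mull // mulnK // andbT mulnC.
  have -> /= : (4 * (s * q) < d)%N by nia.
  by case: (q %| s)%N; rewrite ?mulr1 ?mulr0 ?add0r ?addr0 //= WK.
have cnt : (\sum_(0 <= s < 2 * H) (q %| s) <= 1 + 2 * H %/ q)%N.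
  rewrite big_ltn; last by rewrite muln_gt0.
  by rewrite dvdn0 leq_add2l divn_count_dvd [X in (_ <= X)%N]big_nat_recr ?leq_addr //; lia.
have K1 : (8 * 2 ^ u <= H)%N.
  by apply: leq_trans HE; rewrite -[8%N]/(2 ^ 3)%N -expnD leq_exp2l //; lia.
have K2 : (16 * 2 ^ u <= q)%N.
  apply: leq_trans (ltnW qlo); rewrite -[16%N]/(2 ^ 4)%N -expnD leq_exp2l //; lia.
have cntK : (4 * (2 ^ u * \sum_(0 <= s < 2 * H) (q %| s)) <= H)%N.
  have tr := leq_trunc_div (2 * H) q.
  have := leq_mul (leqnn (8 * 2 ^ u)) cnt.
  have : (8 * 2 ^ u * (2 * H %/ q) <= H)%N.
    rewrite -(leq_pmul2l (isT : 0 < 2)%N); apply: leq_trans tr; rewrite [X in (_ <= X)%N]mulnC !mulnA leq_mul2r.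
    by apply/orP; right; lia.
  exact: slack_count K1.
rewrite big_mkcond -[\sum_(0 <= r < d) _]/(\sum_(0 <= r < d) F r).
move: cntK; rewrite -(ler_nat int) !natrM natrX natr_sum -/K => cntK.
move: low le1 le2 cntK; set A := \sum_(0 <= s < _) W _; set B := \sum_(0 <= s < _) F _.
set C := \sum_(0 <= r < d) F r; set E := \sum_(0 <= s < _) _ => low le1 le2 cntK.
have l4 : H%:R <= 4 * C by lia.
have l5 : d%:R <= 16 * q%:R * H%:R :> int.
  have dH : (d <= 2 * H * (8 * q))%N.
    by apply: leq_trans (ltnW hi) _; rewrite leq_mul2r; apply/orP; right; lia.
  by move: dH; rewrite -(ler_nat int) !natrM => /le_trans; apply; rewrite le_eqVlt; apply/orP; left; apply/eqP; ring.
have := ler_wpM2l (_ : 0 <= 16 * q%:R) l4; rewrite mulr_ge0 // => /(_ isT); lia.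
Qed.
End PrimeLower.

(** * The lower bound *)
(* For a count om, the indicator of om > 0 is at least 1 - (1 - lam * om)^2 = 2 lam om - lam^2 om^2, for any lam. *)
Lemma second_moment_lower (R : realFieldType) (Q rs : seq nat) (w : nat -> R)
    (o : nat -> nat -> bool) (lam : R) : (forall r, 0 <= w r) ->
  2 * lam * (\sum_(q <- Q) \sum_(r <- rs | o q r) w r)
   - lam ^+ 2 * (\sum_(q <- Q) \sum_(q' <- Q) \sum_(r <- rs | o q r && o q' r) w r)
  <= \sum_(r <- rs | has (o^~ r) Q) w r.
Proof.
move=> w0; pose om r : R := \sum_(q <- Q) (o q r)%:R.
have -> : \sum_(q <- Q) \sum_(r <- rs | o q r) w r = \sum_(r <- rs) w r * om r.
  rewrite (eq_bigr (fun q => \sum_(r <- rs) w r * (o q r)%:R)).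
    by rewrite exchange_big /=; apply: eq_bigr => r _; rewrite -mulr_sumr.
  by move=> q _; rewrite big_mkcond; apply: eq_bigr => r _; case: (o q r); rewrite ?mulr1 ?mulr0.
have -> : \sum_(q <- Q) \sum_(q' <- Q) \sum_(r <- rs | o q r && o q' r) w r
    = \sum_(r <- rs) w r * om r ^+ 2.
  rewrite (eq_bigr (fun q => \sum_(r <- rs) w r * (o q r)%:R * om r)).
    rewrite exchange_big /=; apply: eq_bigr => r _.
    by rewrite -mulr_suml -mulr_sumr -mulrA -expr2.
  move=> q _; rewrite (eq_bigr (fun q' => \sum_(r <- rs) w r * (o q r)%:R * (o q' r)%:R)).
    by rewrite exchange_big /=; apply: eq_bigr => r _; rewrite -mulr_sumr.
  move=> q' _; rewrite big_mkcond; apply: eq_bigr => r _.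
  by case: (o q r); case: (o q' r); rewrite ?mulr1 ?mulr0.
rewrite !mulr_sumr -sumrB [X in _ <= X]big_mkcond /=; apply: ler_sum => r _.
have -> : 2 * lam * (w r * om r) - lam ^+ 2 * (w r * om r ^+ 2)
  = w r * (1 - (1 - lam * om r) ^+ 2) by ring.
case: ifP => hr.
  rewrite -[X in _ <= X]mulr1 ler_wpM2l //; have := sqr_ge0 (1 - lam * om r); lra.
have -> : om r = 0; last by rewrite mulr0 subr0 expr1n subrr mulr0.
rewrite /om big_seq big1 // => q qQ; case: (boolP (o q r)) => // oqr.
by move/negbT/hasPn: hr => /(_ q qQ); rewrite oqr.
Qed.

Lemma second_moment_bound (R : realFieldType) (S D T U B k : R) : 0 < k -> 0 <= D -> 1 / 64 <= S ->
  D * S / k <= T -> U <= 2 * D * (S + S ^+ 2) ->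
  (forall lam, 2 * lam * T - lam ^+ 2 * U <= B) -> D <= 130 * k ^+ 2 * B.
Proof.
move=> k0 D0 S1 hT hU hB; have S0 : 0 < 1 + S by lra.
(* The maximizer of the quadratic with T = D S / k and U = 2 D (S + S^2). Its maximum is D S / (2
   k^2 (1 + S)), and S / (1 + S) >= 1/65 since S >= 1/64. *)
pose lam : R := (2 * k * (1 + S))^-1.
have den0 : 0 < 2 * k * (1 + S) by rewrite !mulr_gt0.
have lam0 : 0 <= lam by rewrite invr_ge0 ltW.
have h1 : 2 * lam * (D * S / k) <= 2 * lam * T by apply: ler_wpM2l => //; lra.
have h2 : lam ^+ 2 * U <= lam ^+ 2 * (2 * D * (S + S ^+ 2)) by apply: ler_wpM2l => //; exact: sqr_ge0.
have h3 : 2 * lam * (D * S / k) - lam ^+ 2 * (2 * D * (S + S ^+ 2)) <= B.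
  by apply: le_trans (hB lam); apply: lerB.
have e : 2 * lam * (D * S / k) - lam ^+ 2 * (2 * D * (S + S ^+ 2)) = D * S / (2 * k ^+ 2 * (1 + S)).
  by rewrite /lam; field; rewrite !lt0r_neq0.
rewrite e ler_pdivrMr ?mulr_gt0 ?exprn_gt0 // in h3.
rewrite -(ler_pM2r S0).
have h4 : D * (1 + S) <= 65 * (D * S).
  have := ler_wpM2l D0 S1; lra.
lra.
Qed.

Section Assembly.
Variables (R : realFieldType) (d u : nat).
Hypotheses (sf : squarefree d) (u_big : (300 <= u)%N) (d7 : (d %% 8 = 7)%N).
Hypotheses (d_ge : (2 ^ (200 * u) <= d)%N) (d_lt : (d < 2 ^ (200 * u.+1))%N) (om : (omega d <= u)%N).

Local Notation P := (odd_primes_off d 1).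
Local Notation W := (wt P).

Let d0 : (0 < d)%N. Proof. by apply: leq_trans d_ge; rewrite expn_gt0. Qed.

Let d_odd : odd d. Proof. by have := modn2 d; case: (odd d) => //=; lia. Qed.

Let w r : R := (W r)%:~R.

Let w_ge0 r : 0 <= w r. Proof. by rewrite ler0z; exact: W_ge0. Qed.

Let rs := [seq r <- iota 0 d | (4 * r < d)%N].

Let sum_rs (p : pred nat) : \sum_(r <- rs | p r) w r
  = (\sum_(0 <= r < d | (4 * r < d)%N && p r) W r)%:~R.
Proof. by rewrite rmorph_sum /= /rs big_filter_cond /index_iota subn0. Qed.

Let obstructed_sum_le (Q : seq nat) : all (bad_prime P) Q ->
  \sum_(r <- rs | has (obstructed d ^~ r) Q) w r <= (Dsum d)%:R.
Proof.
move=> bQ; rewrite sum_rs -(rmorph_nat (@intmul R 1)) ler_int.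
apply: sum_wt_le_Dsum => // r /andP[r4 /hasP[q qQ ob]]; split=> //.
  case/and3P: ob => _ + _; case: (r) => // ; by rewrite div0n dvdn0.
exact: obstructed_not_rat_rep d0 sf d7 (allP bQ q qQ) ob.
Qed.

(** Vinogradov's trick: of the mass 7/64 of bad primes up to 2^(101 u + 2), all the primes beyond
    2^(99 u) account for at most 2 (2u + 2) / (99 u) <= 4/64. *)
Lemma bad_prime_mass_below :
  3 / 64 <= \sum_(0 <= q < (2 ^ (99 * u)).+1 | bad_prime P q) q%:R^-1 :> R.
Proof.
have dP : (\prod_(p <- P) p)%N = d by rewrite odd_primes_off1 // squarefree_prod_primes.
set H := (2 ^ (101 * u))%N.
have HD : (H <= \prod_(p <- P) p)%N by rewrite dP; apply: leq_trans d_ge; rewrite leq_exp2l //; lia.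
have H0 : (0 < H)%N by rewrite expn_gt0.
have ue : (201 * u + 208 <= 2 * (101 * u))%N by lia.
have vol := volume_bound u_big d_ge d_lt om 1 (leqnn H) ue.
have := bad_prime_mass R (uniq_odd_primes_off d 1) (prime_odd_primes_off d 1)
  (odd_odd_primes_off d 1) H0 HD vol.
have -> : (4 * H)%N = (2 ^ (101 * u + 2))%N by rewrite /H expnD mulnC.
have le_exp : (99 * u <= 101 * u + 2)%N by lia.
have u0 : (0 < 99 * u)%N by lia.
rewrite (@big_cat_nat _ _ _ (2 ^ (99 * u)).+1) //=; last by rewrite ltnS leq_exp2l.
have between := sum_inv_primes_between R u0 le_exp.
have top : \sum_((2 ^ (99 * u)).+1 <= q < (2 ^ (101 * u + 2)).+1 | bad_prime P q) q%:R^-1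
   <= \sum_((2 ^ (99 * u)).+1 <= q < (2 ^ (101 * u + 2)).+1 | prime q) q%:R^-1 :> R.
  rewrite big_mkcond [X in _ <= X]big_mkcond /=; apply: ler_sum => q _.
  by rewrite /bad_prime; case: (prime q) => //=; case: ifP => //; rewrite invr_ge0.
have small : 2 * (101 * u + 2 - 99 * u)%:R / (99 * u)%:R <= 4 / 64 :> R.
  rewrite ler_pdivrMr ?ltr0n // mulrAC ler_pdivlMr // -!natrM ler_nat; lia.
move: (\sum_(0 <= q < _ | _) _) (le_trans top (le_trans between small)) => A.
move: (\sum_(_ <= q < _ | bad_prime P q) _) => B h1 h2.
lra.
Qed.

Let z := (2 ^ (40 * u))%N.

(** Second moment: [small_prime_lower] bounds the first moment below by d S / 96. Two distinct
    primes obstructing [r] make [r] a multiple of q q', so [multiples_upper] gives 2d S from the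
    diagonal and 2d S^2 from the pairs. *)
Lemma small_mass_bound :
  1 / 64 <= \sum_(0 <= q < z.+1 | bad_prime P q) q%:R^-1 :> R -> d%:R <= 130 * 96 ^+ 2 * (Dsum d)%:R :> R.
Proof.
pose Q := [seq q <- iota 0 z.+1 | bad_prime P q].
have QP q : q \in Q -> [/\ prime q, odd q & (q <= z)%N].
  by rewrite mem_filter mem_iota => /andP[/and3P[-> -> _] ?]; split=> //; lia.
have -> : \sum_(0 <= q < z.+1 | bad_prime P q) q%:R^-1 = \sum_(q <- Q) q%:R^-1 :> R by rewrite big_filter.
set S := \sum_(q <- Q) _ => S1.
pose o := obstructed d.
pose T := \sum_(q <- Q) \sum_(r <- rs | o q r) w r.
pose U := \sum_(q <- Q) \sum_(q' <- Q) \sum_(r <- rs | o q r && o q' r) w r.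
have bQ : all (bad_prime P) Q by apply/allP => q; rewrite mem_filter => /andP[].
have d0R : 0 <= d%:R :> R by [].
have T_ge : d%:R * S / 96 <= T.
  rewrite /S /T mulr_sumr mulr_suml big_seq [X in _ <= X]big_seq; apply: ler_sum => q /QP[q_pr q_odd qz].
  have q0 : 0 < q%:R :> R by rewrite ltr0n prime_gt0.
  have := small_prime_lower sf u_big d_odd d_ge d_lt om q_pr q_odd qz.
  rewrite -(ler_int R) !rmorphM /= !rmorph_nat sum_rs => low.
  by rewrite mulrAC ler_pdivrMr // ler_pdivrMr //; lra.
have mult m : (0 < m)%N -> (m <= 2 ^ (80 * u))%N -> \sum_(r <- rs | (m %| r)%N) w r <= 2 * d%:R / m%:R.
  move=> m0 mu; rewrite ler_pdivlMr ?ltr0n // mulrC sum_rs.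
  have := multiples_upper sf u_big d_ge d_lt om d_odd m0 mu.
  by rewrite -(ler_int R) !rmorphM /= !rmorph_nat.
have pair q q' : q \in Q -> q' \in Q ->
    \sum_(r <- rs | o q r && o q' r) w r <= (if q == q' then 2 * d%:R / q%:R else 0) + 2 * d%:R / (q%:R * q'%:R).
  move=> /QP[q_pr _ qz] /QP[q'_pr _ q'z].
  have [q0 q'0] := (prime_gt0 q_pr, prime_gt0 q'_pr).
  have mono m : (forall r, o q r && o q' r -> (m %| r)%N) ->
      \sum_(r <- rs | o q r && o q' r) w r <= \sum_(r <- rs | (m %| r)%N) w r.
    move=> h; rewrite big_mkcond [X in _ <= X]big_mkcond /=; apply: ler_sum => r _.
    by case: ifP => [/h -> //|_]; case: ifP.
  have zz : (z * z <= 2 ^ (80 * u))%N by rewrite -expnD leq_exp2l //; lia.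
  case: eqVneq => [eqq'|neq].
    apply: (@le_trans _ _ (2 * d%:R / q%:R)); last by rewrite lerDl divr_ge0 ?mulr_ge0.
    apply: (le_trans (mono q _)); first by move=> r /andP[/and3P[]].
    by apply: mult => //; apply: leq_trans qz _; rewrite leq_exp2l //; lia.
  rewrite add0r -[q%:R * _]natrM; apply: (le_trans (mono (q * q')%N _)).
    move=> r /andP[/and3P[qr _ _] /and3P[q'r _ _]]; rewrite Gauss_dvd ?qr //.
    by rewrite prime_coprime // dvdn_prime2.
  by apply: mult; [rewrite muln_gt0 q0 | apply: leq_trans zz; exact: leq_mul].
have U_le : U <= 2 * d%:R * (S + S ^+ 2).
  have -> : 2 * d%:R * (S + S ^+ 2) = \sum_(q <- Q) \sum_(q' <- Q)
     ((if q == q' then 2 * d%:R / q%:R else 0) + 2 * d%:R / (q%:R * q'%:R)).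
    rewrite mulrDr /S mulr_sumr expr2 big_distrlr mulr_sumr /= -big_split /= big_seq [RHS]big_seq.
    apply: eq_bigr => q qQ; rewrite big_split /=; congr (_ + _).
      rewrite [RHS](bigD1_seq q) ?filter_uniq ?iota_uniq //= eqxx big1 ?addr0 //.
      by move=> q' /negbTE; rewrite eq_sym => ->.
    by rewrite mulr_sumr; apply: eq_bigr => q' _; rewrite invfM.
  rewrite /U big_seq [X in _ <= X]big_seq; apply: ler_sum => q qQ.
  by rewrite big_seq [X in _ <= X]big_seq; apply: ler_sum => q' q'Q; apply: pair.
have k0 : 0 < 96 :> R by [].
apply: (second_moment_bound k0 d0R S1 T_ge U_le) => lam.
exact: le_trans (second_moment_lower Q rs o lam w_ge0) (obstructed_sum_le bQ).
Qed.

(** Six such primes would have a product of at least z^6 = 2^(240 u), beyond [d]. *)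
Lemma large_prime_multiplicity (Q : seq nat) (r : nat) : uniq Q ->
  {in Q, forall q, prime q /\ (z < q)%N} -> (0 < r < d)%N -> (count (fun q => q %| r)%N Q <= 5)%N.
Proof.
move=> uQ QP /andP[r0 rd]; rewrite -size_filter; set s := filter _ Q.
have sP q : q \in s -> [/\ prime q, (z <= q)%N & (q %| r)%N].
  by rewrite mem_filter => /andP[qr /QP[q_pr /ltnW]].
have dvd : (\prod_(q <- s) q %| r)%N.
  apply: prod_primes_dvd; first exact: filter_uniq.
    by apply/allP => q /sP[].
  by move=> q /sP[].
have low : (z ^ size s <= \prod_(q <- s) q)%N.
  have : {in s, forall q, z <= q}%N by move=> q /sP[].
  elim: (s) => [|q t IH] h; first by rewrite big_nil.
  rewrite big_cons /= expnS leq_mul ?h ?mem_head // IH // => x xt.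
  by apply: h; rewrite inE xt orbT.
have := leq_ltn_trans (leq_trans low (dvdn_leq r0 dvd)) (ltn_trans rd d_lt).
by rewrite -expnM ltn_exp2l //; nia.
Qed.

(** Since each [r] is counted at most five times, the first moment alone suffices. *)
Lemma large_mass_bound :
  2 / 64 <= \sum_(z.+1 <= q < (2 ^ (99 * u)).+1 | bad_prime P q) q%:R^-1 :> R ->
  d%:R <= 5 * 64 * 64 * (Dsum d)%:R :> R.
Proof.
set y := (2 ^ (99 * u)).+1.
pose Q := [seq q <- index_iota z.+1 y | bad_prime P q && ~~ (q %| d)%N].
have QP q : q \in Q -> [/\ prime q, odd q, ~~ (q %| d)%N, (z < q)%N & (q <= 2 ^ (99 * u))%N].
  by rewrite mem_filter mem_index_iota => /andP[/andP[/and3P[-> -> _] ->] /andP[-> ?]].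
rewrite (bigID (fun q => q %| d)%N) /=.
(* [large_prime_lower] excludes primes dividing [d]; at most u of these exceed z = 2^(40 u), so
   discarding them costs little. *)
have ram : \sum_(z.+1 <= q < y | bad_prime P q && (q %| d)%N) q%:R^-1 <= 1 / 64 :> R.
  have z0 : 0 < z%:R :> R by rewrite ltr0n expn_gt0.
  apply: (@le_trans _ _ (\sum_(z.+1 <= q < y | bad_prime P q && (q %| d)%N) z%:R^-1)).
    rewrite big_nat_cond [X in _ <= X]big_nat_cond; apply: ler_sum => q /andP[/andP[zq _] _].
    have q0 : (0 < q)%N by apply: leq_trans zq.
    by rewrite lef_pV2 ?posrE // ?ltr0n // ler_nat ltnW.
  rewrite -big_filter big_const_seq count_predT iter_addr addr0 -[_ *+ _]mulr_natl.
  rewrite ler_pdivrMr // mulrAC ler_pdivlMr // mul1r -natrM ler_nat.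
  have szu : (size [seq q <- index_iota z.+1 y | bad_prime P q && (q %| d)%N] <= u)%N.
    apply: leq_trans om; apply: uniq_leq_size; first by rewrite filter_uniq ?iota_uniq.
    by move=> q; rewrite mem_filter mem_primes d0 => /andP[/andP[/and3P[-> _ _] ->] _].
  apply: (@leq_trans (2 ^ u * 2 ^ 6)); first by rewrite leq_mul // (leq_trans szu) // ltnW // ltn_expl.
  by rewrite -expnD leq_exp2l //; lia.
have -> : \sum_(z.+1 <= q < y | bad_prime P q && ~~ (q %| d)%N) q%:R^-1
   = \sum_(q <- Q) q%:R^-1 :> R by rewrite big_filter.
move: ram; set S0 := \sum_(_ <= q < _ | _) _; set S := \sum_(q <- Q) _ => S0_le S_ge.
have S1 : 1 / 64 <= S by lra.
pose o := obstructed d.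
have bQ : all (bad_prime P) Q by apply/allP => q; rewrite mem_filter => /andP[/andP[]].
have T_ge : d%:R * S / 64 <= \sum_(q <- Q) \sum_(r <- rs | o q r) w r.
  rewrite /S mulr_sumr mulr_suml big_seq [X in _ <= X]big_seq; apply: ler_sum => q /QP[q_pr q_odd qd qz qy].
  have q0 : 0 < q%:R :> R by rewrite ltr0n prime_gt0.
  have := large_prime_lower sf u_big d_odd d_ge d_lt om q_pr q_odd qd qz qy.
  rewrite -(ler_int R) !rmorphM /= !rmorph_nat sum_rs => low.
  by rewrite mulrAC ler_pdivrMr // ler_pdivrMr //; lra.
have T_le : \sum_(q <- Q) \sum_(r <- rs | o q r) w r <= 5 * \sum_(r <- rs | has (o^~ r) Q) w r.
  rewrite (eq_bigr (fun q => \sum_(r <- rs) (o q r)%:R * w r)); last first.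
    by move=> q _; rewrite big_mkcond; apply: eq_bigr => r _; case: (o q r); rewrite ?mul1r ?mul0r.
  rewrite exchange_big /= mulr_sumr [X in _ <= X]big_mkcond big_seq [X in _ <= X]big_seq; apply: ler_sum => r rI.
  rewrite -mulr_suml; have [hr|nr] := boolP (has (o^~ r) Q); last first.
    rewrite big_seq big1 ?mul0r // => q qQ; case: (boolP (o q r)) => // oqr.
    by move/hasPn: nr => /(_ q qQ); rewrite oqr.
  apply: ler_wpM2r => //; rewrite -natr_sum ler_nat.
  have r_pos : (0 < r)%N.
    by case/hasP: hr => q _ /and3P[_ + _]; case: (r) => //; rewrite div0n dvdn0.
  have rd : (r < d)%N by move: rI; rewrite mem_filter mem_iota => /and3P[].
  apply: leq_trans (large_prime_multiplicity (Q := Q) (r := r) _ _ _).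
  - rewrite -sum1_count [X in (_ <= X)%N]big_mkcond /=; apply: leq_sum => q _.
    by rewrite /o /obstructed; case: (q %| r)%N; rewrite ?leq_b1.
  - by rewrite filter_uniq ?iota_uniq.
  - by move=> q /QP[q_pr _ _ zq _].
  - by rewrite r_pos.
have := le_trans T_ge (le_trans T_le (ler_wpM2l (ler0n R 5) (obstructed_sum_le bQ))).
rewrite ler_pdivrMr // => main.
have dS := ler_wpM2l (ler0n R d) S1.
lra.
Qed.

Lemma seven_mod_eight_lower : d%:R <= 130 * 96 ^+ 2 * (Dsum d)%:R :> R.
Proof.
have mass := bad_prime_mass_below.
have zy : (z <= 2 ^ (99 * u))%N by rewrite leq_exp2l //; lia.
rewrite (@big_cat_nat _ _ _ z.+1) //= in mass.
(* Of the total mass 3/64, either 1/64 lies at or below z or 2/64 lies above it. *)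
have [small|large] := lerP (1 / 64) (\sum_(0 <= q < z.+1 | bad_prime P q) q%:R^-1 : R).
  exact: small_mass_bound.
have := large_mass_bound; move: mass large.
set A := \sum_(0 <= q < _ | _) _; set B := \sum_(_ <= q < _ | _) _ => mass large h.
have Dd : 0 <= (Dsum d)%:R :> R by [].
have h2 : 2 / 64 <= B by lra.
by have := h h2; lra.
Qed.
End Assembly.

Theorem theorem4p3 (R : realType) :
  exists c : R, 0 < c /\
  exists N : nat, forall d : nat, (N <= d)%N -> (0 < d)%N -> squarefree d ->
    c * d%:R <= (Dsum d)%:R.
Proof.
(* This constant also exceeds 5 * 64^2, from the large primes, and 256, from the 2-adic case. *)
have K0 : 0 < 130 * 96 ^+ 2 :> R by rewrite mulr_gt0 // exprn_gt0.
exists (130 * 96 ^+ 2)^-1; split; first by rewrite invr_gt0.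
have [N hN] := dyadic_scale 300; exists N => d Nd d0 sf.
have [u [u_big d_ge d_lt om]] := hN d Nd.
rewrite ler_pdivrMl //.
have [d7|d7] := eqVneq (d %% 8)%N 7%N.
  exact: (seven_mod_eight_lower R sf u_big d7 d_ge d_lt om).
have := two_adic_lower sf u_big d_ge d_lt om d7.
rewrite -(ler_int R) !rmorphM /= !rmorph_nat => low.
have Dd : 0 <= (Dsum d)%:R :> R by [].
lra.
Qed.
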